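(* Let $\mathfrak n=\mathfrak n_1\oplus\mathfrak n_2$ be an $8$-dimensional real vector space, where $\mathfrak n_1$ has basis $X_1,\dots,X_4$ and $\mathfrak n_2$ has basis $Z_1,\dots,Z_4$. Let $J_1,J_2,J_3$ be the endomorphisms preserving $\mathfrak n_1$ and $\mathfrak n_2$ and acting on each of them, with respect to the given basis (written $e_1,\dots,e_4$), by $$J_1e_1=e_2,\ J_1e_2=-e_1,\ J_1e_3=e_4,\ J_1e_4=-e_3;\quad J_2e_1=e_3,\ J_2e_2=-e_4,\ J_2e_3=-e_1,\ J_2e_4=e_2;\quad J_3=J_1J_2,$$ and let $\langle\cdot,\cdot\rangle$ be the inner product making $\{X_i\}\cup\{Z_i\}$ orthonormal. For $0\le t\le\frac1{\sqrt3}$ let $\mu_t$ be the $2$-step nilpotent Lie bracket whose only non-zero brackets, up to skew-symmetry, are $$\mu_t(X_1,X_2)=\sqrt{1-3t^2}\,Z_1+tZ_2,\quad \mu_t(X_3,X_4)=-\sqrt{1-3t^2}\,Z_1+tZ_2,$$ $$\mu_t(X_1,X_3)=tZ_3,\quad \mu_t(X_2,X_4)=-tZ_3,\quad \mu_t(X_1,X_4)=tZ_4,\quad \mu_t(X_2,X_3)=tZ_4 .$$ Then: (i) $(N_{\mu_t},\{J_1,J_2,J_3\})$ is always non-abelian hypercomplex (here $\mu_t(X_2,X_3)+\mu_t(X_1,X_4)=2tZ_4$), and $\langle\cdot,\cdot\rangle$ is a minimal compatible metric for it; (ii) $\mathrm{Ric}_{\mu_t}|_{\mathfrak n_2}=\mathrm{diag}(1-3t^2,t^2,t^2,t^2)$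 in the basis $Z_1,\dots,Z_4$, from which it follows that the curve of Riemannian manifolds $(N_{\mu_t},\langle\cdot,\cdot\rangle)$, $0\le t\le\frac{1}{\sqrt3}$, is pairwise non-isometric, and hence the curve of hypercomplex nilpotent Lie groups $(N_{\mu_t},\{J_1,J_2,J_3\})$ is pairwise non-isomorphic; (iii) the starting and ending points are $(\mathfrak n,\mu_0)\simeq\mathfrak g_1$ and $(\mathfrak n,\mu_{1/\sqrt3})\simeq\mathfrak g_3$, respectively, and $(\mathfrak n,\mu_t)$ is isomorphic to the $2$-step nilpotent Lie algebra $\mathfrak u(2)\oplus\mathbb C^2$ for any $0<t<\frac1{\sqrt3}$.
   Context: $\mathfrak g_1$ is the direct sum of the $5$-dimensional real Heisenberg Lie algebra and $\mathbb R^3$; $\mathfrak g_3$ is the direct sum of the $7$-dimensional quaternionic Heisenberg Lie algebra ($\mathbb H\oplus\operatorname{Im}\mathbb H$ with center $\operatorname{Im}\mathbb H$ and $[x,y]=\operatorname{Im}(\bar x y)$ for $x,y\in\mathbb H$) and $\mathbb R$. The $2$-step nilpotent Lie algebra $\mathfrak u(2)\oplus\mathbb C^2$ is the one constructed from the standard representation $\pi$ of $\mathfrak u(2)$ on $\mathbb C^2\cong\mathbb R^4$: as a vector space it is $\mathfrak u(2)\oplus\mathbb C^2$, the subspace $\mathfrak u(2)$ is central, and the bracket $\mathbb C^2\times\mathbb C^2\to\mathfrak u(2)$ is defined by $\langle[v,w],x\rangle=\langle\pi(x)v,w\rangle$ for $v,w\in\mathbb C^2$, $x\in\mathfrak u(2)$,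 where the inner products are an $\operatorname{Ad}$-invariant inner product on $\mathfrak u(2)$ and the (real part of the) standard one on $\mathbb C^2$. For a nilpotent Lie bracket $\mu$ on $\mathfrak n$, $N_\mu$ denotes the simply connected nilpotent Lie group with Lie algebra $(\mathfrak n,\mu)$; tensors on $\mathfrak n$ define left invariant structures on $N_\mu$. A triple $\{J_1,J_2,J_3\}$ of endomorphisms with $J_i^2=-I$, $J_1J_2=J_3=-J_2J_1$ is a hypercomplex structure on $N_\mu$ if each $J=J_i$ satisfies $\mu(JX,JY)=\mu(X,Y)+J\mu(JX,Y)+J\mu(X,JY)$ for all $X,Y\in\mathfrak n$; it is abelian if $\mu(J_iX,J_iY)=\mu(X,Y)$ for all $X,Y$ and $i=1,2,3$. Two hypercomplex nilpotent Lie groups are isomorphic if there is a Lie algebra isomorphism $\varphi$ between their Lie algebras with $\varphi J_i'\varphi^{-1}=J_i$, $i=1,2,3$. An inner product is compatible if $\langle J_iX,J_iY\rangle=\langle X,Y\rangle$ for all $X,Y$ and $i=1,2,3$. With $\mathrm{Ric}$ the Ricci operator of $(N_\mu,\langle\cdot,\cdot\rangle)$, the invariant Ricci operator is $\mathrm{Ric}^\gamma=\frac14(\mathrm{Ric}-J_1\mathrm{Ric}J_1-J_2\mathrm{Ric}J_2-J_3\mathrm{Ric}J_3)$. A compatible metric is called minimal if it minimizes $\operatorname{tr}(\mathrm{Ric}^\gamma)^2$ among all left invariant metrics compatible with $(N_\mu,\{J_1,J_2,J_3\})$ having the same scalar curvature.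
   Formalization: In (i), ''always non-abelian'' fails at t=0, where μ_0(J_iX,J_iY)=μ_0(X,Y) for i=1,2,3; the formal statement says instead that the hypercomplex structure is abelian if and only if t=0, so it is non-abelian for 0<t≤1/√3. *)

(* Defs.v *)
From HB Require Import structures.
From mathcomp Require Import all_boot all_order all_algebra.
From mathcomp Require Import all_classical all_reals topology normedtype derive.
From mathcomp Require Import complex ring.

Set Implicit Arguments.
Unset Strict Implicit.
Unset Printing Implicit Defensive.
Import Order.TTheory GRing.Theory Num.Theory.
Import numFieldNormedType.Exports.
Local Open Scope ring_scope.

Section LieAlgebras.
Variable R : realType.

Definition bilinear_map (U V W : lmodType R) (b : U -> V -> W) : Prop :=
  (forall v, linear (b^~ v)) /\ (forall u, linear (b u)).

Definition lie_bracket (V : lmodType R) (mu : V -> V -> V) : Prop :=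
  [/\ bilinear_map mu, (forall x, mu x x = 0)
    & forall x y z, mu x (mu y z) + mu y (mu z x) + mu z (mu x y) = 0].

Definition two_step (V : lmodType R) (mu : V -> V -> V) : Prop :=
  (forall x y z, mu (mu x y) z = 0) /\ (exists x y, mu x y != 0).

Definition lie_morphism (V W : lmodType R)
    (mu : V -> V -> V) (nu : W -> W -> W) (phi : V -> W) : Prop :=
  linear phi /\ forall x y, phi (mu x y) = nu (phi x) (phi y).

Definition lie_isomorphic (V W : lmodType R)
    (mu : V -> V -> V) (nu : W -> W -> W) : Prop :=
  exists2 phi : V -> W, lie_morphism mu nu phi & bijective phi.

Definition abelian_bracket (V : lmodType R) : V -> V -> V := fun _ _ => 0.

Definition sum_bracket (V W : lmodType R)
    (mu : V -> V -> V) (nu : W -> W -> W) : V * W -> V * W -> V * W :=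
  fun x y => (mu x.1 y.1, nu x.2 y.2).

(* The bracket on U (+) V for which U is central and [v, w] = beta v w. *)
Definition central_bracket (U V : lmodType R)
    (beta : V -> V -> U) : U * V -> U * V -> U * V :=
  fun x y => (beta x.2 y.2, 0).

Definition inner_product (V : lmodType R) (g : V -> V -> R) : Prop :=
  [/\ bilinear_map (g : V -> V -> R^o), (forall x y, g x y = g y x)
    & forall x, x != 0 -> 0 < g x x].

(* The Heisenberg algebra of dimension 2n+1: [x_i, y_i] = z. *)
Definition heisenberg (n : nat) :
    R^o * ('rV[R]_n * 'rV[R]_n) -> R^o * ('rV[R]_n * 'rV[R]_n) ->
    R^o * ('rV[R]_n * 'rV[R]_n) :=
  central_bracket (fun u v : 'rV[R]_n * 'rV[R]_n =>
    \sum_(i < n) (u.1 0 i * v.2 0 i - u.2 0 i * v.1 0 i) : R^o).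

Definition g1_bracket :=
  sum_bracket (@heisenberg 2) (@abelian_bracket 'rV[R]_3).

(* (a, b, c, d) stands for a + bi + cj + dk. *)
Definition quat : lmodType R := (R^o * R^o * R^o * R^o)%type.
Definition im_quat : lmodType R := (R^o * R^o * R^o)%type.

Definition qconj (x : quat) : quat :=
  let: (a, b, c, d) := x in (a, - b, - c, - d).

Definition qmul (x y : quat) : quat :=
  let: (a, b, c, d) := x in let: (a', b', c', d') := y in
  (a * a' - b * b' - c * c' - d * d',
   a * b' + b * a' + c * d' - d * c',
   a * c' - b * d' + c * a' + d * b',
   a * d' + b * c' - c * b' + d * a').

Definition qim (x : quat) : im_quat := let: (a, b, c, d) := x in (b, c, d).

Definition quat_heisenberg :
    im_quat * quat -> im_quat * quat -> im_quat * quat :=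
  central_bracket (fun x y => qim (qmul (qconj x) y)).

Definition g3_bracket :=
  sum_bracket quat_heisenberg (@abelian_bracket R^o).

End LieAlgebras.

(* The real vector space underlying a complex one. *)
Section Realification.
Variables (R : realType) (W : lmodType R[i]).

Definition realified : Type := W.
HB.instance Definition _ := GRing.Zmodule.on realified.

Definition real_scale (a : R) (w : realified) : realified :=
  (real_complex R a) *: (w : W).

Fact real_scaleA a b w : real_scale a (real_scale b w) = real_scale (a * b) w.
Proof. by rewrite /real_scale scalerA -rmorphM. Qed.
Fact real_scale1 : left_id 1 real_scale.
Proof. by move=> w; rewrite /real_scale rmorph1 scale1r. Qed.
Fact real_scaleDr : right_distributive real_scale +%R.
Proof. by move=> a u v; rewrite /real_scale scalerDr. Qed.
Fact real_scaleDl w : {morph real_scale^~ w : a b / a + b}.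
Proof. by move=> a b; rewrite /real_scale rmorphD scalerDl. Qed.

HB.instance Definition _ := GRing.Zmodule_isLmodule.Build R realified
  real_scaleA real_scale1 real_scaleDr real_scaleDl.
End Realification.

Section U2.
Variable R : realType.

Definition adjoint m n (A : 'M[R[i]]_(m, n)) : 'M[R[i]]_(n, m) :=
  (map_mx (@conjc R) A)^T.

Definition skew_hermitian : {pred realified 'M[R[i]]_2} :=
  [pred A | adjoint A == - (A : 'M[R[i]]_2)].

Fact skew_hermitian_submod : submod_closed skew_hermitian.
Proof.
split=> [|a A B].
  by rewrite inE /adjoint; apply/eqP/matrixP=> i j; rewrite !mxE oppr0 conjc0.
rewrite !inE => /eqP hA /eqP hB; apply/eqP.
have HA i j : conjc (A j i) = - A i j by move/matrixP/(_ i j): hA; rewrite !mxE.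
have HB' i j : conjc (B j i) = - B i j by move/matrixP/(_ i j): hB; rewrite !mxE.
apply/matrixP=> i j; rewrite !mxE rmorphD rmorphM /= HA HB' oppr0.
by rewrite mulrN opprD.
Qed.

HB.instance Definition _ := GRing.isSubmodClosed.Build R
  (realified 'M[R[i]]_2) skew_hermitian skew_hermitian_submod.

Record u2 := U2 { u2_val :> realified 'M[R[i]]_2; _ : u2_val \in skew_hermitian }.
HB.instance Definition _ := [isSub for u2_val].
HB.instance Definition _ := [Choice of u2 by <:].
HB.instance Definition _ := [SubChoice_isSubLmodule of u2 by <:].

Definition C2 : lmodType R := realified 'cV[R[i]]_2.

Definition u2_rep (x : u2) (v : C2) : C2 :=
  (u2_val x : 'M[R[i]]_2) *m (v : 'cV[R[i]]_2).

Definition C2_inner (v w : C2) : R :=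
  complex.Re ((adjoint (v : 'cV[R[i]]_2) *m (w : 'cV[R[i]]_2)) 0 0).

Definition Ad_invariant (B : u2 -> u2 -> R) : Prop :=
  forall (g : 'M[R[i]]_2) (x y x' y' : u2), g *m adjoint g = 1%:M ->
    (u2_val x' : 'M[R[i]]_2) = g *m (u2_val x : 'M[R[i]]_2) *m adjoint g ->
    (u2_val y' : 'M[R[i]]_2) = g *m (u2_val y : 'M[R[i]]_2) *m adjoint g ->
    B x' y' = B x y.

Definition rep_pairing (B : u2 -> u2 -> R) (beta : C2 -> C2 -> u2) : Prop :=
  forall v w x, B (beta v w) x = C2_inner (u2_rep x v) w.

Definition u2_inner (x y : u2) : R :=
  complex.Re (\tr (adjoint (u2_val x : 'M[R[i]]_2) *m (u2_val y : 'M[R[i]]_2))).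

Fact u2_inner_Ad_invariant : inner_product u2_inner /\ Ad_invariant u2_inner.
Proof.
pose q (a b : R[i]) : R :=
  complex.Re a * complex.Re b + complex.Im a * complex.Im b.
have E x y : u2_inner x y =
    \sum_i \sum_j q ((u2_val x : 'M_2) j i) ((u2_val y : 'M_2) j i).
  rewrite /u2_inner /mxtrace raddf_sum; apply: eq_bigr => i _.
  rewrite mxE raddf_sum; apply: eq_bigr => j _; rewrite !mxE /q.
  by case: (u2_val x j i) (u2_val y j i) => [a b] [c d] /=; rewrite mulNr opprK.
have q0 a : 0 <= q a a by rewrite /q -!expr2 addr_ge0 ?sqr_ge0.
have C x y : u2_inner x y = u2_inner y x.
  by rewrite !E; do 2!(apply: eq_bigr => ? _); rewrite /q; congr (_ + _); rewrite mulrC.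
have L v : linear (u2_inner^~ v : _ -> R^o).
  move=> a x y; rewrite !E scaler_sumr -big_split; apply: eq_bigr => i _.
  rewrite scaler_sumr -big_split; apply: eq_bigr => j _ /=.
  rewrite linearP /= !mxE /q /=.
  case: (u2_val x j i) (u2_val y j i) (u2_val v j i) => [? ?] [? ?] [? ?] /=.
  rewrite /GRing.scale /=; ring.
split; first split=> //.
- by split=> // u a x y; rewrite ![u2_inner u _]C L.
- move=> x; apply: contraNT; rewrite -leNgt E => x0.
  apply/eqP/val_inj/matrixP=> j i.
  have Q k : 0 <= \sum_l q ((u2_val x : 'M_2) l k) ((u2_val x : 'M_2) l k).
    by apply: sumr_ge0 => ? _.
  have /eqP x1 : \sum_k \sum_l q ((u2_val x : 'M_2) l k) ((u2_val x : 'M_2) l k)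
      == 0 by rewrite eq_le x0 sumr_ge0.
  have x2 := psumr_eq0P (fun k _ => Q k) x1.
  have /(_ j isT)/eqP := psumr_eq0P (fun l _ => q0 _) (x2 i isT).
  rewrite raddf0 !mxE /q -!expr2 paddr_eq0 ?sqr_ge0 // !sqrf_eq0.
  move=> /andP[/eqP a /eqP b]; move: a b; rewrite /=.
  by case: (u2_val x j i) => [? ?] /= -> ->.
- move=> g x y x' y' gg hx hy; rewrite /u2_inner hx hy.
  have aM (A B : 'M[R[i]]_2) : adjoint (A *m B) = adjoint B *m adjoint A.
    by rewrite /adjoint map_mxM trmx_mul.
  have aK : adjoint (adjoint g) = g.
    by apply/matrixP=> i j; rewrite !mxE conjcK.
  rewrite !aM aK mulmxA mxtrace_mulC !mulmxA (mulmx1C gg) mul1mx.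
  by rewrite -!mulmxA (mulmxA (adjoint g)) (mulmx1C gg) mul1mx.
Qed.

End U2.

Section LeftInvariantGeometry.
Variables (R : realType) (n : nat).
Notation V := 'rV[R]_n.
Implicit Types (mu : V -> V -> V) (g : V -> V -> R) (J : V -> V).

Definition trace (f : V -> V) : R := \tr (lin1_mx f).

Definition gram g : 'M[R]_n := \matrix_(i, j) g (delta_mx 0 i) (delta_mx 0 j).

(* The vector v with g v w = alpha w for all w. *)
Definition sharp g (alpha : V -> R) : V :=
  (\row_j alpha (delta_mx 0 j)) *m invmx (gram g).

(* Koszul formula for left invariant vector fields. *)
Definition levi_civita mu g (x y : V) : V :=
  sharp g (fun z => 2^-1 * (g (mu x y) z - g (mu y z) x + g (mu z x) y)).

Definition curvature mu g (x y z : V) : V :=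
  let D := levi_civita mu g in D x (D y z) - D y (D x z) - D (mu x y) z.

Definition ricci_form mu g (y z : V) : R :=
  trace (fun x => curvature mu g x y z).

Definition ricci mu g (y : V) : V := sharp g (ricci_form mu g y).

Definition scalar_curvature mu g : R := trace (ricci mu g).

Definition invariant_ricci mu g J1 J2 J3 (x : V) : V :=
  4^-1 *: (ricci mu g x - J1 (ricci mu g (J1 x)) - J2 (ricci mu g (J2 x))
           - J3 (ricci mu g (J3 x))).

Definition hypercomplex mu J1 J2 J3 : Prop :=
  [/\ [/\ linear J1, linear J2 & linear J3],
      [/\ forall x, J1 (J1 x) = - x, forall x, J2 (J2 x) = - x
        & forall x, J3 (J3 x) = - x],
      (forall x, J1 (J2 x) = J3 x /\ J3 x = - J2 (J1 x))
    & forall J, [\/ J = J1, J = J2 | J = J3] ->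
        forall x y, mu (J x) (J y) = mu x y + J (mu (J x) y) + J (mu x (J y))].

Definition abelian_hypercomplex mu J1 J2 J3 : Prop :=
  forall J, [\/ J = J1, J = J2 | J = J3] ->
    forall x y, mu (J x) (J y) = mu x y.

Definition hypercomplex_isomorphic mu J1 J2 J3 mu' J1' J2' J3' : Prop :=
  exists phi : V -> V, [/\ lie_morphism mu' mu phi, bijective phi
    & [/\ forall x, phi (J1' x) = J1 (phi x),
          forall x, phi (J2' x) = J2 (phi x)
        & forall x, phi (J3' x) = J3 (phi x)]].

Definition compatible_metric J1 J2 J3 g : Prop :=
  inner_product g /\
  forall J, [\/ J = J1, J = J2 | J = J3] ->
    forall x y, g (J x) (J y) = g x y.

Definition ricci_gamma_sq mu J1 J2 J3 g : R :=
  trace (invariant_ricci mu g J1 J2 J3 \o invariant_ricci mu g J1 J2 J3).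

Definition minimal_metric mu J1 J2 J3 g : Prop :=
  compatible_metric J1 J2 J3 g /\
  forall g', compatible_metric J1 J2 J3 g' ->
    scalar_curvature mu g' = scalar_curvature mu g ->
    ricci_gamma_sq mu J1 J2 J3 g <= ricci_gamma_sq mu J1 J2 J3 g'.

(* For mu 2-step nilpotent, N_mu is V with the Baker-Campbell-Hausdorff
   product, in which the inverse of p is - p. *)
Definition nil_mul mu (p q : V) : V := p + q + 2^-1 *: mu p q.

Definition left_invariant_metric mu g (p u v : V) : R :=
  let L := nil_mul mu (- p) in g ('d L p u) ('d L p v).

Fixpoint Ck (k : nat) (f : V -> V) : Prop :=
  if k is k'.+1 then
    (forall p, differentiable f p) /\ (forall v, Ck k' (fun p => 'd f p v))
  else continuous f.

Definition smooth (f : V -> V) : Prop := forall k, Ck k f.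

(* Riemannian metrics on the manifold V are given as maps p, u, v |-> h_p(u, v),
   the tangent spaces being identified with V. *)
Definition isometric_manifolds (h h' : V -> V -> V -> R) : Prop :=
  exists f f' : V -> V, [/\ smooth f, smooth f', cancel f f', cancel f' f
    & forall p u v, h' (f p) ('d f p u) ('d f p v) = h p u v].

End LeftInvariantGeometry.

Section Curve.
Variable R : realType.

(* R^4 with basis e 1, ..., e 4 (numbered from 1) and coordinates co 1, ..., co 4. *)
Definition e (k : nat) : 'rV[R]_4 := delta_mx 0 (inord k.-1).
Definition co (k : nat) (x : 'rV[R]_4) : R := x 0 (inord k.-1).

Definition X (k : nat) : 'rV[R]_(4 + 4) := row_mx (e k) 0.
Definition Z (k : nat) : 'rV[R]_(4 + 4) := row_mx 0 (e k).

Definition j1 (x : 'rV[R]_4) : 'rV[R]_4 :=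
  co 1 x *: e 2 - co 2 x *: e 1 + co 3 x *: e 4 - co 4 x *: e 3.
Definition j2 (x : 'rV[R]_4) : 'rV[R]_4 :=
  co 1 x *: e 3 - co 2 x *: e 4 - co 3 x *: e 1 + co 4 x *: e 2.

Definition J1 (x : 'rV[R]_(4 + 4)) : 'rV[R]_(4 + 4) :=
  row_mx (j1 (lsubmx x)) (j1 (rsubmx x)).
Definition J2 (x : 'rV[R]_(4 + 4)) : 'rV[R]_(4 + 4) :=
  row_mx (j2 (lsubmx x)) (j2 (rsubmx x)).
Definition J3 (x : 'rV[R]_(4 + 4)) : 'rV[R]_(4 + 4) := J1 (J2 x).

Definition ip (x y : 'rV[R]_(4 + 4)) : R := \sum_i x 0 i * y 0 i.

Definition wedge (i j : nat) (x y : 'rV[R]_(4 + 4)) : R :=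
  co i (lsubmx x) * co j (lsubmx y) - co j (lsubmx x) * co i (lsubmx y).

Definition mu (t : R) (x y : 'rV[R]_(4 + 4)) : 'rV[R]_(4 + 4) :=
  let s := Num.sqrt (1 - 3 * t ^+ 2) in
    wedge 1 2 x y *: (s *: Z 1 + t *: Z 2)
  + wedge 3 4 x y *: (- s *: Z 1 + t *: Z 2)
  + wedge 1 3 x y *: (t *: Z 3) + wedge 2 4 x y *: (- t *: Z 3)
  + wedge 1 4 x y *: (t *: Z 4) + wedge 2 3 x y *: (t *: Z 4).

Fact lsubmx_mu t x y : lsubmx (mu t x y) = 0.
Proof.
rewrite /mu /Z !scale_row_mx !add_row_mx !scale_row_mx !add_row_mx row_mxKl.
by rewrite !(scaler0, addr0).
Qed.

Fact mu_lie_bracket t : lie_bracket (mu t).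
Proof.
have add i a x y :
    co i (lsubmx (a *: x + y)) = a * co i (lsubmx x) + co i (lsubmx y).
  by rewrite /co !mxE.
have mu0 x y z : mu t x (mu t y z) = 0.
  rewrite {1}/mu /wedge !lsubmx_mu.
  have co0 k : co k 0 = 0 by rewrite /co mxE.
  by rewrite !co0 !(mulr0, mul0r, subrr, scale0r, addr0).
split; [split=> [v a x y|u a x y]|move=> x|by move=> x y z; rewrite !mu0 !addr0].
- by rewrite /mu /wedge !add; apply/rowP=> k; rewrite !mxE; ring.
- by rewrite /mu /wedge !add; apply/rowP=> k; rewrite !mxE; ring.
- by rewrite /mu /wedge; apply/rowP=> k; rewrite !mxE; ring.
Qed.

Fact coe i k : (0 < i <= 4)%N -> (0 < k <= 4)%N -> co i (e k) = (i == k)%:R.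
Proof.
case: i k => // i [] // k; rewrite !ltnS => hi hk.
by rewrite /co /e mxE eqxx /= -val_eqE /= !inordK // eqSS.
Qed.

Fact mu_table t :
  let s := Num.sqrt (1 - 3 * t ^+ 2) in
  [/\ mu t (X 1) (X 2) = s *: Z 1 + t *: Z 2,
      mu t (X 3) (X 4) = - s *: Z 1 + t *: Z 2,
      mu t (X 1) (X 3) = t *: Z 3 &
      [/\ mu t (X 2) (X 4) = - t *: Z 3, mu t (X 1) (X 4) = t *: Z 4
        & mu t (X 2) (X 3) = t *: Z 4]].
Proof.
by move=> s; rewrite /s; split; [| | |split]; rewrite /mu /wedge /X !row_mxKl !coe //=
  !(mulr0, mul0r, subrr, subr0, sub0r, mulr1, scale0r, scale1r, addr0, add0r, oppr0).
Qed.

Fact mu_two_step t : two_step (mu t).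
Proof.
split=> [x y z|].
  have co0 k : co k 0 = 0 by rewrite /co mxE.
  by rewrite {1}/mu /wedge !lsubmx_mu !co0 !(mulr0, mul0r, subrr, scale0r, addr0).
have [m12 _ m13 _] := mu_table t.
have Z0 k : (0 < k <= 4)%N -> Z k != 0.
  move=> hk; apply/eqP=> /(congr1 (fun v => co k (rsubmx v))).
  by rewrite row_mxKr coe // eqxx /co !mxE => /eqP; rewrite oner_eq0.
have [t0|t0] := eqVneq t 0; last first.
  by exists (X 1), (X 3); rewrite m13 scaler_eq0 negb_or t0 Z0.
exists (X 1), (X 2); rewrite m12 t0 expr0n mulr0 subr0 sqrtr1 scale1r scale0r.
by rewrite addr0 Z0.
Qed.

End Curve.

(* Main.v *)
From HB Require Import structures.
Require Import Defs.
From mathcomp Require Import all_boot all_order all_algebra.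
From mathcomp Require Import all_classical all_reals topology normedtype derive.
From mathcomp Require Import complex ring lra.

Set Implicit Arguments.
Unset Strict Implicit.
Unset Printing Implicit Defensive.
Import Order.TTheory GRing.Theory Num.Theory.
Import numFieldNormedType.Exports.
Local Open Scope ring_scope.

(** For a 2-step bracket with values in the span n2 of the Z_i, the Ricci operator of any metric
    has traces 2 sc on the orthogonal complement of n2 and - sc on n2, where sc is the
    scalar curvature. For a compatible metric the invariant Ricci operator has the same two
    traces, so Cauchy-Schwarz bounds the trace of its square from below by (5/4) sc^2, with
    equality when it is a scalar on each summand, as it is for mu_t. A smooth isometry f
    between the groups, read in left invariant frames, is a field A(p) of orthogonal maps.
    The Maurer-Cartan equation (symmetry of the second derivatives of f) and orthogonality
    determine the derivative of A as in Koszul's formula, and symmetry of the second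
    derivatives of A then shows that A(p) intertwines the curvature tensors. Hence the Ricci
    operators are conjugate, and their spectra determine t. A hypercomplex isomorphism
    preserves n2 and acts on n / n2 and on n2 by quaternionic similarities; rescaling these
    gives an isometry up to a factor of the bracket which the scalar curvature forces to be
    1 or -1. *)

(** Two obstacles shape the proof: a competing compatible metric need not make n1 and n2 orthogonal,
    and an isometry need not be a group homomorphism. The first is met by a triangular change of
    basis, which turns the metric into the standard one and alters the bracket and the J_i but keeps
    n2 in place. The second is met by working in left invariant frames, where metric and curvature
    have constant coefficients: intertwining the curvature at a single point is then a statement
    about tensors on one vector space, and traces of powers of the Ricci operator finish the
    argument without any bracket being preserved. The subspace n2 is fixed in advance instead of
    being read off from the derived algebra, which at t = 0 and t = 1/sqrt 3 is strictly smaller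
    than n2 and is not stable under the J_i. *)

Local Notation "''e_' i" := (delta_mx 0 i : 'rV[_]__) (at level 8, i at level 2).

(** * Inner products and the Ricci operator *)

Section RawLinear.
Variables (R : realType) (U V : lmodType R) (f : U -> V).
Hypothesis hf : linear f.

(** The definitions speak of bare functions with a linearity hypothesis; packing one gives access to
    the library's results on bundled linear maps. *)
Definition Lin : {linear U -> V} := HB.pack f (GRing.isLinear.Build R U V _ f hf).

Lemma lin0 : f 0 = 0. Proof. exact: (linear0 Lin). Qed.
Lemma linD : {morph f : x y / x + y}. Proof. exact: (linearD Lin). Qed.
Lemma linN : {morph f : x / - x}. Proof. exact: (linearN Lin). Qed.
Lemma linB : {morph f : x y / x - y}. Proof. exact: (linearB Lin). Qed.
Lemma linZ a : {morph f : x / a *: x}. Proof. by move=> x; rewrite -[a *: x]addr0 hf lin0 addr0. Qed.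
Lemma lin_sum I r (P : pred I) E :
  f (\sum_(i <- r | P i) E i) = \sum_(i <- r | P i) f (E i).
Proof. exact: (linear_sum Lin). Qed.
End RawLinear.

Section Dot.
Variables (R : realType) (n : nat).
Notation V := 'rV[R]_n.

Definition dot (x y : V) : R := \sum_i x 0 i * y 0 i.

Lemma rV_basis (x : V) : x = \sum_i x 0 i *: 'e_i.
Proof. exact: row_sum_delta. Qed.

Lemma deltaE i j : ('e_i : V) 0 j = (i == j)%:R.
Proof. by rewrite mxE eqxx eq_sym. Qed.

Lemma dotC x y : dot x y = dot y x.
Proof. by apply: eq_bigr => i _; rewrite mulrC. Qed.

Lemma dotl y : linear (dot^~ y : V -> R^o).
Proof.
move=> a u v; rewrite /dot scaler_sumr -big_split; apply: eq_bigr => i _ /=.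
by rewrite !mxE mulrDl -mulrA.
Qed.

Lemma dotr x : linear (dot x : V -> R^o).
Proof. by move=> a u v; rewrite ![dot x _]dotC dotl. Qed.

Lemma dotDl x y z : dot (x + y) z = dot x z + dot y z. Proof. exact: (linD (dotl z)). Qed.
Lemma dotNl x z : dot (- x) z = - dot x z. Proof. exact: (linN (dotl z)). Qed.
Lemma dotNr x z : dot z (- x) = - dot z x. Proof. exact: (linN (dotr z)). Qed.
Lemma dotBl x y z : dot (x - y) z = dot x z - dot y z. Proof. exact: (linB (dotl z)). Qed.
Lemma dotBr x y z : dot z (x - y) = dot z x - dot z y. Proof. exact: (linB (dotr z)). Qed.
Lemma dotZl a x z : dot (a *: x) z = a * dot x z. Proof. exact: (linZ (dotl z)). Qed.
Lemma dotZr a x z : dot z (a *: x) = a * dot z x. Proof. exact: (linZ (dotr z)). Qed.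
Lemma dot0l z : dot 0 z = 0. Proof. exact: (lin0 (dotl z)). Qed.
Lemma dot0r z : dot z 0 = 0. Proof. exact: (lin0 (dotr z)). Qed.

Lemma dot_delta x i : dot x 'e_i = x 0 i.
Proof.
rewrite /dot (bigD1 i) //= deltaE eqxx mulr1 big1 ?addr0 // => j ji.
by rewrite deltaE eq_sym (negPf ji) mulr0.
Qed.

Lemma dot_inj x y : (forall z, dot x z = dot y z) -> x = y.
Proof. by move=> h; apply/rowP=> i; rewrite -!dot_delta h. Qed.

Lemma dot_ge0 x : 0 <= dot x x.
Proof. by apply: sumr_ge0 => i _; rewrite -expr2 sqr_ge0. Qed.

Lemma dot_eq0 x : dot x x = 0 -> x = 0.
Proof.
move=> h; apply/rowP=> i; rewrite mxE.
have /(_ i isT)/eqP := psumr_eq0P (fun (i : 'I_n) _ => sqr_ge0 (x 0 i)) h.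
by rewrite sqrf_eq0 => /eqP.
Qed.

Lemma dot_inner : inner_product dot.
Proof.
split; [by split; [exact: dotl | exact: dotr]|exact: dotC|move=> x x0].
by rewrite lt_neqAle dot_ge0 andbT eq_sym; apply: contra_neq x0; exact: dot_eq0.
Qed.

Lemma trace_dot (f : V -> V) : trace f = \sum_i dot (f 'e_i) 'e_i.
Proof. by apply: eq_bigr => i _; rewrite dot_delta mxE. Qed.

Lemma lin1_mxE (f : V -> V) x : linear f -> f x = x *m lin1_mx f.
Proof. by move=> hf; exact/esym/(mul_rV_lin1 (Lin hf)). Qed.

Lemma trace_conj (f f' P : V -> V) : linear f -> linear f' -> linear P ->
  bijective P -> (forall x, P (f x) = f' (P x)) -> trace f = trace f'.
Proof.
move=> hf hf' hP [Q PQ QP] h; rewrite /trace.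
set F := lin1_mx f; set F' := lin1_mx f'; set M := lin1_mx P.
have FM : F *m M = M *m F'.
  by apply/row_matrixP=> i; rewrite !rowE !mulmxA -!lin1_mxE.
have hQ : linear Q by move=> a u v; apply: (can_inj PQ); rewrite hP !QP.
have MN : lin1_mx Q *m M = 1%:M.
  by apply/row_matrixP=> i; rewrite !rowE mulmxA -!lin1_mxE // QP mulmx1.
by rewrite -[F]mulmx1 -(mulmx1C MN) mulmxA FM mxtrace_mulC mulmxA MN mul1mx.
Qed.

End Dot.

Section InnerProducts.
Variables (R : realType) (n : nat).
Notation V := 'rV[R]_n.
Variable g : V -> V -> R.
Hypothesis gI : inner_product g.

Lemma ipl y : linear (g^~ y : V -> R^o). Proof. by case: gI => -[]. Qed.
Lemma ipr x : linear (g x : V -> R^o). Proof. by case: gI => -[]. Qed.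
Lemma ipC x y : g x y = g y x. Proof. by case: gI. Qed.
Lemma ip_gt0 x : x != 0 -> 0 < g x x. Proof. by case: gI => _ _; apply. Qed.

Lemma ip_inj x y : (forall z, g x z = g y z) -> x = y.
Proof.
move=> h; apply/eqP; rewrite -subr_eq0; apply/eqP/eqP.
apply: contraT => /ip_gt0; rewrite (linB (ipl (x - y))) /= h subrr.
by rewrite ltxx.
Qed.

Lemma ip_gram x y : g x y = dot (x *m gram g) y.
Proof.
rewrite {1}[x]rV_basis (lin_sum (ipl y)) /dot.
under [RHS]eq_bigr => j _ do rewrite mxE mulr_suml.
rewrite exchange_big; apply: eq_bigr => i _.
rewrite (linZ (ipl y)) {1}[y]rV_basis (lin_sum (ipr _)) scaler_sumr.
apply: eq_bigr => j _; rewrite (linZ (ipr _)) /= !mxE /GRing.scale /=; ring.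
Qed.

Lemma gram_unit : gram g \in unitmx.
Proof.
rewrite -row_free_unit; apply/inj_row_free => v vG.
by apply: ip_inj => z; rewrite !ip_gram vG mul0mx.
Qed.

Lemma sharpE (alpha : V -> R) z : linear (alpha : V -> R^o) ->
  g (sharp g alpha) z = alpha z.
Proof.
move=> ha; rewrite ip_gram /sharp mulmxKV ?gram_unit //.
rewrite [in RHS](rV_basis z) (lin_sum ha) /dot; apply: eq_bigr => i _.
by rewrite (linZ ha) mxE mulrC.
Qed.

Lemma sharp_linear (U : lmodType R) (a : U -> V -> R) :
  (forall z, linear (a^~ z : U -> R^o)) -> linear (fun u => sharp g (a u)).
Proof.
move=> h c u v; rewrite /sharp scalemxAl -mulmxDl; congr (_ *m _).
by apply/rowP=> j; rewrite !mxE h.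
Qed.

Variable mu : V -> V -> V.
Hypothesis muB : bilinear_map mu.

Lemma bil_l y : linear (mu^~ y). Proof. by case: muB. Qed.
Lemma bil_r x : linear (mu x). Proof. by case: muB. Qed.

Let Kform x y z := 2^-1 * (g (mu x y) z - g (mu y z) x + g (mu z x) y).

Lemma Kform_l y z : linear (fun x => Kform x y z : R^o).
Proof.
move=> a u v; rewrite /Kform (bil_l _ a u v) (bil_r _ a u v).
rewrite (ipl z a (mu u y)) (ipr _ a u v) (ipl y a (mu z u)) /GRing.scale /=; ring.
Qed.
Lemma Kform_m x z : linear (fun y => Kform x y z : R^o).
Proof.
move=> a u v; rewrite /Kform (bil_l _ a u v) (bil_r _ a u v).
rewrite (ipl z a (mu x u)) (ipr _ a u v) (ipl x a (mu u z)) /GRing.scale /=; ring.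
Qed.
Lemma Kform_r x y : linear (fun z => Kform x y z : R^o).
Proof.
move=> a u v; rewrite /Kform (bil_l _ a u v) (bil_r _ a u v).
rewrite (ipl x a (mu y u)) (ipr _ a u v) (ipl y a (mu u x)) /GRing.scale /=; ring.
Qed.

Lemma koszul x y z : g (levi_civita mu g x y) z =
  2^-1 * (g (mu x y) z - g (mu y z) x + g (mu z x) y).
Proof. by rewrite sharpE //; exact: Kform_r. Qed.

Lemma levi_civita_l y : linear ((levi_civita mu g)^~ y).
Proof. exact: (sharp_linear (fun z => Kform_l y z)). Qed.
Lemma levi_civita_r x : linear (levi_civita mu g x).
Proof. exact: (sharp_linear (fun z => Kform_m x z)). Qed.

Lemma curvature_1 y z : linear (fun x => curvature mu g x y z).
Proof.
move=> a u v; rewrite /curvature !(bil_l _ a u v) !levi_civita_l levi_civita_r.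
by apply/rowP=> i; rewrite !mxE; ring.
Qed.
Lemma curvature_2 x z : linear (fun y => curvature mu g x y z).
Proof.
move=> a u v; rewrite /curvature !(bil_r _ a u v) !levi_civita_l levi_civita_r.
by apply/rowP=> i; rewrite !mxE; ring.
Qed.
Lemma curvature_3 x y : linear (curvature mu g x y).
Proof.
move=> a u v; rewrite /curvature !levi_civita_r.
by apply/rowP=> i; rewrite !mxE; ring.
Qed.

Lemma ricci_form_l z : linear (fun y => ricci_form mu g y z : R^o).
Proof.
move=> a u v; rewrite /ricci_form !trace_dot scaler_sumr -big_split /=.
by apply: eq_bigr => i _; rewrite curvature_2 dotDl dotZl.
Qed.
Lemma ricci_form_r y : linear (ricci_form mu g y : V -> R^o).
Proof.
move=> a u v; rewrite /ricci_form !trace_dot scaler_sumr -big_split /=.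
by apply: eq_bigr => i _; rewrite curvature_3 dotDl dotZl.
Qed.

Lemma ricciE x y : g (ricci mu g x) y = ricci_form mu g x y.
Proof. by rewrite sharpE //; exact: ricci_form_r. Qed.

Lemma ricci_linear : linear (ricci mu g).
Proof. exact: (sharp_linear ricci_form_l). Qed.

End InnerProducts.

Section Naturality.
Variables (R : realType) (n : nat).
Notation V := 'rV[R]_n.
Variables (mu mu' : V -> V -> V) (g g' : V -> V -> R) (P : V -> V).
Hypotheses (muB : bilinear_map mu) (muB' : bilinear_map mu').
Hypotheses (gI : inner_product g) (gI' : inner_product g').
Hypotheses (PL : linear P) (PB : bijective P).
Hypothesis Pg : forall x y, g' (P x) (P y) = g x y.

(** Only the curvature tensors are assumed to correspond, not the brackets: this is all that the
    differential of an isometry provides. *)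
Lemma ricci_natural_curvature :
  (forall x y z, P (curvature mu g x y z) = curvature mu' g' (P x) (P y) (P z)) ->
  forall x, P (ricci mu g x) = ricci mu' g' (P x).
Proof.
move=> h x; have [Q PQ QP] := PB; apply: (ip_inj gI') => z.
rewrite -(QP z) Pg !ricciE // /ricci_form; apply: (trace_conj _ _ PL PB) => //; exact: curvature_1.
Qed.

Hypothesis Pmu : forall x y, P (mu x y) = mu' (P x) (P y).

Lemma levi_civita_natural x y :
  P (levi_civita mu g x y) = levi_civita mu' g' (P x) (P y).
Proof.
have [Q PQ QP] := PB; apply: (ip_inj gI') => z.
by rewrite -(QP z) Pg !koszul // -!Pmu !Pg.
Qed.

Lemma curvature_natural x y z :
  P (curvature mu g x y z) = curvature mu' g' (P x) (P y) (P z).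
Proof. by rewrite /curvature !(linB PL) !levi_civita_natural Pmu. Qed.

Lemma ricci_natural x : P (ricci mu g x) = ricci mu' g' (P x).
Proof. exact: ricci_natural_curvature curvature_natural x. Qed.

End Naturality.

(** * Two-step nilpotent brackets and their Ricci form *)

Section NilpotentBrackets.
Variables (R : realType) (n : nat).
Notation V := 'rV[R]_n.

Definition nil2 (mu : V -> V -> V) :=
  [/\ bilinear_map mu, forall x, mu x x = 0 & forall x y z, mu (mu x y) z = 0].

Lemma nil2_anti mu x y : nil2 mu -> mu y x = - mu x y.
Proof.
case=> b h _; apply/eqP; rewrite -subr_eq0 opprK addrC; apply/eqP.
by have := h (x + y); rewrite (linD (bil_l b _)) /= !(linD (bil_r b _)) !h add0r addr0.
Qed.

Lemma nil2_central mu x y z : nil2 mu -> mu z (mu x y) = 0.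
Proof. by move=> h; rewrite (nil2_anti _ z h); case: h => _ _ ->; rewrite oppr0. Qed.

End NilpotentBrackets.

Section TwoStep.
Variables (R : realType) (m n : nat).
Notation V := 'rV[R]_(m + n).

(** The last n coordinates span a central subspace containing all brackets. It may exceed the
    derived algebra, so that one notion covers the whole curve including its endpoints. *)
Definition adapted (mu : V -> V -> V) :=
  [/\ bilinear_map mu, forall x, mu x x = 0, forall x y, lsubmx (mu x y) = 0
    & forall x z, lsubmx z = 0 -> mu z x = 0].

Variable mu : V -> V -> V.
Hypothesis muA : adapted mu.

Let muB : bilinear_map mu. Proof. by case: muA. Qed.

Lemma adapted_nil2 : nil2 mu.
Proof. by case: muA => b h l c; split=> // x y z; apply: c; exact: l. Qed.

Let adapted_anti x y : mu y x = - mu x y. Proof. exact: nil2_anti adapted_nil2. Qed.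

(** Either ['e_i] is central, or it is orthogonal to all brackets. This removes the first of the
    three curvature terms from the Ricci form. *)
Lemma adapted_trace w i : dot (mu 'e_i w) 'e_i = 0.
Proof.
case: muA => _ _ h c; rewrite dot_delta; have [j ->|j ->] := split_ordP i.
  by have /rowP/(_ j) := h 'e_(lshift n j) w; rewrite !mxE.
rewrite c ?mxE //; apply/rowP=> k; rewrite !mxE eqxx /=.
by rewrite -val_eqE /= ltn_eqF // ltn_addr.
Qed.

(** In the Ricci computation the two summands agree only after symmetrization in the two indices. *)
Lemma sum_sym_eq k (F G : 'I_k -> 'I_k -> R) :
  (forall i j, F i j + F j i = G i j + G j i) ->
  \sum_i \sum_j F i j = \sum_i \sum_j G i j.
Proof.
move=> h; have two (H : 'I_k -> 'I_k -> R) :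
    \sum_i \sum_j (H i j + H j i) = 2 * \sum_i \sum_j H i j.
  rewrite mulr_natl mulr2n [X in _ + X]exchange_big -big_split; apply: eq_bigr => i _.
  by rewrite -big_split.
have two0 : 2 != 0 :> R by rewrite pnatr_eq0.
apply: (mulfI two0); rewrite -!two.
by do 2!apply: eq_bigr => ? _.
Qed.

Lemma ricci_formE y z : ricci_form mu (@dot R _) y z =
  4^-1 * (\sum_i \sum_k dot (mu 'e_i 'e_k) y * dot (mu 'e_i 'e_k) z)
  - 2^-1 * \sum_i dot (mu y 'e_i) (mu z 'e_i).
Proof.
pose g := @dot R (m + n); pose D := levi_civita mu g.
have gI : inner_product g := @dot_inner R _.
have K a b c : dot (D a b) c =
    2^-1 * (dot (mu a b) c - dot (mu b c) a + dot (mu c a) b).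
  exact: (koszul gI).
have skew a b c : dot (D a b) c = - dot b (D a c).
  rewrite [dot b _]dotC !K (adapted_anti b a) (adapted_anti c a).
  by rewrite (adapted_anti c b) !dotNl; ring.
have curvE x : curvature mu g x y z = D x (D y z) - D y (D x z) - D (mu x y) z by [].
rewrite /ricci_form trace_dot; under eq_bigr => i _ do rewrite curvE !dotBl.
have E1 i w : dot (D 'e_i w) 'e_i = 0.
  have := adapted_trace w i; case: muA => _ alt _ _.
  rewrite K alt dot0l (adapted_anti 'e_i w) dotNl => ->.
  by rewrite oppr0 subrr addr0 mulr0.
(* The argument [mu 'e_i y] is central, so a single term of Koszul's formula survives. *)
have E3 i : dot (D (mu 'e_i y) z) 'e_i = 2^-1 * dot (mu y 'e_i) (mu z 'e_i).
  have [_ _ c0] := adapted_nil2; rewrite K c0 (nil2_central _ _ _ adapted_nil2).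
  rewrite dot0l dot0l (adapted_anti y 'e_i) dotNr [dot (mu y _) _]dotC; ring.
under eq_bigr => i _ do rewrite E1 sub0r skew opprK E3.
rewrite big_split /= sumrN -mulr_sumr; congr (_ - _).
pose F i k := dot (D 'e_i z) 'e_k * dot (D y 'e_i) 'e_k.
(* The subtracted part sums over k to a multiple of <[e_i, [y, e_i]], z> = 0; it is present to make
   the symmetrizations of [F] and [G] equal. *)
pose G i k := 4^-1 * (dot (mu 'e_i 'e_k) y * dot (mu 'e_i 'e_k) z)
  - 2^-1 * (dot (mu 'e_i 'e_k) z * dot (mu y 'e_i) 'e_k).
transitivity (\sum_i \sum_k F i k).
  by do 2!apply: eq_bigr => ? _; rewrite /F !dot_delta.
rewrite (@sum_sym_eq _ F G).
  rewrite /G mulr_sumr; apply: eq_bigr => i _; rewrite big_split /= sumrN -!mulr_sumr.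
  rewrite [X in _ - _ * X](_ : _ = dot (mu 'e_i (mu y 'e_i)) z).
    by rewrite (nil2_central _ _ _ adapted_nil2) dot0l mulr0 subr0.
  rewrite {2}[mu y _]rV_basis (lin_sum (bil_r muB _)) (lin_sum (dotl z)).
  apply: eq_bigr => k _.
  by rewrite (linZ (bil_r muB _)) dotZl mulrC dot_delta.
move=> i k; rewrite /F /G !K.
rewrite (adapted_anti 'e_i 'e_k) (adapted_anti z 'e_i) (adapted_anti z 'e_k).
rewrite (adapted_anti y 'e_i) (adapted_anti y 'e_k) !dotNl; by field.
Qed.

End TwoStep.

(** * Minimality *)

Section Cholesky.
Variable R : realType.

Lemma dot_mx n (x y : 'rV[R]_n) : dot x y = (x *m y^T) 0 0.
Proof. by rewrite mxE; apply: eq_bigr => i _; rewrite mxE. Qed.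

Lemma dot_mulmx m n (x : 'rV[R]_m) (A : 'M_(m, n)) y :
  dot (x *m A) y = dot x (y *m A^T).
Proof. by rewrite !dot_mx trmx_mul trmxK mulmxA. Qed.

Lemma dot_row_mx m n (x x' : 'rV[R]_m) (y y' : 'rV[R]_n) :
  dot (row_mx x y) (row_mx x' y') = dot x x' + dot y y'.
Proof. by rewrite !dot_mx tr_row_mx mul_row_col mxE. Qed.

Lemma dot1 (x y : 'rV[R]_1) : dot x y = x 0 0 * y 0 0.
Proof. by rewrite /dot big_ord1. Qed.

Lemma cholesky n (G : 'M[R]_n) : G^T = G ->
  (forall v : 'rV_n, v != 0 -> 0 < dot (v *m G) v) ->
  exists2 Q : 'M_n, G = Q *m Q^T & forall i j : 'I_n, (j < i)%N -> Q i j = 0.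
Proof.
elim: n G => [|n IH] G GT Gpos.
  by exists 0; [rewrite mul0mx; apply/matrixP=> -[]|move=> -[]].
pose H : 'M_(1 + n) := G.
pose a := ulsubmx H 0 0; pose b := ursubmx H; pose K := drsubmx H.
have HE : H = block_mx a%:M b b^T K.
  rewrite -[LHS]submxK -mx11_scalar; congr block_mx.
  by rewrite /b trmx_ursub; congr dlsubmx; rewrite /H GT.
have Hpos x (v : 'rV_n) : row_mx x%:M v != 0 ->
    0 < x ^+ 2 * a + 2 * x * dot b v + dot (v *m K) v.
  have Hp : forall w : 'rV_(1 + n), w != 0 -> 0 < dot (w *m H) w := Gpos.
  move=> /Hp; rewrite HE mul_row_block dot_row_mx !dotDl !dot1.
  rewrite !mul_scalar_mx dotZl !mxE eqxx mulr1n.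
  have -> : \sum_j v 0 j * b^T j 0 = dot b v.
    by apply: eq_bigr => j _; rewrite mxE mulrC.
  by rewrite /= !mulr1n => ?; lra.
have KT : K^T = K by rewrite /K trmx_drsub; congr drsubmx.
have Kpos v : v != 0 -> 0 < dot (v *m K) v.
  move=> v0; have := Hpos 0 v; rewrite expr0n /= !(mul0r, mulr0, add0r); apply.
  by apply: contra v0 => /eqP/(congr1 rsubmx); rewrite row_mxKr => ->; rewrite linear0.
have [Q KQ Qt] := IH K KT Kpos.
have Ku : K \in unitmx.
  rewrite -row_free_unit; apply/inj_row_free => v vK; apply/eqP.
  by apply: contraT => /Kpos; rewrite vK dot0l ltxx.
have Qu : Q \in unitmx by move: Ku; rewrite KQ unitmx_mul => /andP[].
(* Forced by comparing the upper right blocks of [H = B *m B^T]. *)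
pose c := b *m invmx Q^T.
have cQ : c *m Q^T = b by rewrite mulmxKV // unitmx_tr.
(* The Schur complement a - b K^-1 b^T is the value of the form at the vector (1, - b K^-1), hence
   positive. *)
have c2 : dot c c < a.
  have w0 : row_mx (1%:M : 'M[R]_1) (- (b *m invmx K)) != 0.
    by apply/eqP=> /(congr1 lsubmx); rewrite row_mxKl linear0 => /matrixP/(_ 0 0);
      rewrite !mxE => /eqP; rewrite oner_eq0.
  have := Hpos _ _ w0; rewrite mulNmx mulmxKV // dotNl !dotNr expr1n mul1r mulr1.
  have -> : dot b (b *m invmx K) = dot c c.
    have -> : c = b *m invmx K *m Q.
      by rewrite /c -[in LHS](mulmxKV Ku b) {2}KQ mulmxA mulmxK // unitmx_tr.
    by rewrite dot_mulmx -mulmxA -KQ mulmxKV // dotC.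
  lra.
pose B : 'M_(1 + n) := block_mx (Num.sqrt (a - dot c c))%:M c 0 Q.
have HB : H = B *m B^T.
  rewrite HE tr_block_mx mulmx_block trmx0 !mul0mx !mulmx0 !add0r.
  have bT : b^T = Q *m c^T by rewrite -cQ trmx_mul trmxK.
  rewrite cQ -KQ -bT; congr block_mx.
  apply/matrixP=> i j; rewrite !ord1 [RHS]mxE -!dot_mx dot1 !mxE eqxx.
  by rewrite !mulr1n -expr2 sqr_sqrtr ?subr_ge0 ?ltW // subrK.
exists B => //; suff Bt : forall i j : 'I_(1 + n), (j < i)%N -> B i j = 0 by [].
move=> i j; have [i' ->|i' ->] := split_ordP i; first by rewrite ord1.
have [j' ->|j' ->] := split_ordP j; first by rewrite block_mxEdl mxE.
by rewrite /= ltn_add2l block_mxEdr; exact: Qt.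
Qed.

(* The triangular Cholesky factor makes every inner product the standard one while preserving the last n coordinates. *)
Lemma inner_product_dot m n (g : 'rV[R]_(m + n) -> 'rV_(m + n) -> R) : inner_product g ->
  exists P : 'rV[R]_(m + n) -> 'rV[R]_(m + n), [/\ linear P, bijective P,
    forall x y, dot (P x) (P y) = g x y
    & forall x, lsubmx x = 0 <-> lsubmx (P x) = 0].
Proof.
move=> gI; have [Q GQ Qt] : exists2 Q, gram g = Q *m Q^T
    & forall i j : 'I_(m + n), (j < i)%N -> Q i j = 0.
  apply: cholesky => [|v v0]; first by apply/matrixP=> i j; rewrite !mxE (ipC gI).
  by rewrite -(ip_gram gI) (ip_gt0 gI).
have Qu : Q \in unitmx.
  by have := gram_unit gI; rewrite GQ unitmx_mul => /andP[].
have Q0 : dlsubmx Q = 0.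
  by apply/matrixP=> i j; rewrite !mxE Qt //= ltn_addr.
have QE x : lsubmx (x *m Q) = lsubmx x *m ulsubmx Q.
  rewrite -[x in LHS]hsubmxK -[Q in LHS]submxK Q0 mul_row_block row_mxKl.
  by rewrite mulmx0 addr0.
have Qul : ulsubmx Q \in unitmx.
  move: Qu; rewrite !unitmxE -{1}[Q]submxK Q0 det_ublock unitrM.
  by case/andP.
exists (fun x => x *m Q); split.
- by move=> a u v; rewrite mulmxDl scalemxAl.
- by exists (fun x => x *m invmx Q) => x; rewrite ?mulmxK ?mulmxKV.
- by move=> x y; rewrite dotC dot_mulmx -mulmxA -GQ dotC -(ip_gram gI).
- move=> x; rewrite QE; split=> [->|h]; first by rewrite mul0mx.
  by rewrite -(mulmxK Qul (lsubmx x)) h mul0mx.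
Qed.

End Cholesky.

Section Minimality.
Variables (R : realType) (m n : nat).
Notation V := 'rV[R]_(m + n).

(** k times the difference of the two sides is the sum of the squares of the deviations k a_i -
    s. *)
Lemma sum_sqr_ge k (a : 'I_k -> R) :
  (\sum_i a i) ^+ 2 <= k%:R * \sum_i a i ^+ 2.
Proof.
case: k a => [|k] a; first by rewrite !big_ord0 expr0n mulr0.
set s := \sum_i a i; set q := \sum_i a i ^+ 2.
have : 0 <= \sum_i (k.+1%:R * a i - s) ^+ 2 by apply: sumr_ge0 => i _; exact: sqr_ge0.
have -> : \sum_i (k.+1%:R * a i - s) ^+ 2 = k.+1%:R * (k.+1%:R * q - s ^+ 2).
  have E i : (k.+1%:R * a i - s) ^+ 2 =
    k.+1%:R ^+ 2 * a i ^+ 2 + (- (2 * k.+1%:R * s)) * a i + s ^+ 2 by ring.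
  under eq_bigr => i _ do rewrite E.
  rewrite !big_split /= -!mulr_sumr -/s -/q sumr_const card_ord -mulr_natl; ring.
by rewrite pmulr_rge0 ?ltr0n // subr_ge0.
Qed.

(** Composing with this projection makes the trace of a diagonal block the trace of an operator, to
    which conjugation by the J_i applies. *)
Definition left_part (x : V) : V := row_mx (lsubmx x) 0.

Lemma left_part_linear : linear left_part.
Proof.
by move=> a u v; rewrite /left_part linearP scale_row_mx scaler0 add_row_mx addr0.
Qed.

Lemma left_part_lshift i : left_part 'e_(lshift n i) = 'e_(lshift n i).
Proof. by rewrite delta_mx_lshift /left_part row_mxKl. Qed.

Lemma left_part_rshift i : left_part 'e_(rshift m i) = 0.
Proof. by rewrite delta_mx_rshift /left_part row_mxKl row_mx0. Qed.

Lemma trace_left (f : V -> V) : f 0 = 0 ->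
  trace (f \o left_part) = \sum_i dot (f 'e_(lshift n i)) 'e_(lshift n i).
Proof.
move=> f0; rewrite trace_dot big_split_ord /= [X in _ + X]big1 ?addr0 => [|i _].
  by apply: eq_bigr => i _; rewrite left_part_lshift.
by rewrite left_part_rshift f0 dot0l.
Qed.

Lemma invariant_ricci_linear mu g J1 J2 J3 : inner_product g -> bilinear_map mu ->
  linear J1 -> linear J2 -> linear J3 -> linear (invariant_ricci mu g J1 J2 J3 : V -> V).
Proof.
move=> gI B L1 L2 L3 a u v; rewrite /invariant_ricci !(L1, L2, L3, ricci_linear gI B).
move: (ricci mu g u) (ricci mu g v) (J1 (ricci mu g (J1 u))) (J1 (ricci mu g (J1 v))).
move: (J2 (ricci mu g (J2 u))) (J2 (ricci mu g (J2 v))).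
move: (J3 (ricci mu g (J3 u))) (J3 (ricci mu g (J3 v))).
by move=> *; apply/rowP=> i; rewrite !mxE; ring.
Qed.

Section StandardMetric.
Variable mu : V -> V -> V.
Hypothesis muA : adapted mu.
Let Ric := ricci mu (@dot R _).
Let muB : bilinear_map mu. Proof. by case: muA. Qed.
Let gI := @dot_inner R (m + n).
Let RicL : linear Ric. Proof. exact: ricci_linear. Qed.

Let S := \sum_i \sum_k dot (mu 'e_i 'e_k) (mu 'e_i 'e_k).

Lemma ricci_sym x y : dot (Ric x) y = dot x (Ric y).
Proof.
rewrite [RHS]dotC !ricciE // !ricci_formE //.
by congr (_ * _ - _ * _); [do 2!apply: eq_bigr => ? _; rewrite mulrC|
  apply: eq_bigr => ? _; rewrite dotC].
Qed.

Lemma trace_ricci : trace Ric = - 4^-1 * S.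
Proof.
rewrite trace_dot.
under eq_bigr => i _ do rewrite ricciE // ricci_formE //.
rewrite big_split /= sumrN -!mulr_sumr -/S.
rewrite [X in _ * X - _](_ : _ = S); first by field.
rewrite exchange_big; apply: eq_bigr => i _; rewrite exchange_big.
by apply: eq_bigr => j _; apply: eq_bigr => k _; rewrite dot_delta.
Qed.

(** On the first summand the first sum of [ricci_formE] vanishes, brackets being orthogonal to it;
    the second sum still yields all of [S], because the omitted basis vectors are central. *)
Lemma trace_ricci_left : trace (Ric \o left_part) = - 2^-1 * S.
Proof.
rewrite trace_left ?(lin0 RicL) //.
under eq_bigr => i _ do rewrite ricciE // ricci_formE //.
rewrite big_split /= sumrN -!mulr_sumr big1 ?mulr0 ?add0r ?mulNr => [|i _].
  congr (- (_ * _)); rewrite /S big_split_ord /= [X in _ = _ + X]big1 ?addr0 // => i _.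
  case: muA => _ _ _ c; apply: big1 => k _.
  by rewrite c ?dot0l // delta_mx_rshift row_mxKl.
apply: big1 => j _; apply: big1 => k _; rewrite dot_delta.
have -> : mu 'e_j 'e_k 0 (lshift n i) = lsubmx (mu 'e_j 'e_k) 0 i by rewrite mxE.
by case: muA => _ _ -> _; rewrite mxE mul0r.
Qed.

(** For symmetric [A] the trace of the square is the sum of all squared entries. Keeping the
    diagonal ones and applying Cauchy-Schwarz to each block gives the bound, so the off-diagonal
    blocks may be arbitrary. *)
Lemma trace_sqr_ge (A : V -> V) : (0 < m)%N -> (0 < n)%N -> linear A ->
  (forall x y, dot (A x) y = dot x (A y)) ->
  trace (A \o left_part) ^+ 2 / m%:R + (trace A - trace (A \o left_part)) ^+ 2 / n%:R
    <= trace (A \o A).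
Proof.
move=> m0 n0 AL As; rewrite trace_left ?(lin0 AL) //.
rewrite [trace A]trace_dot big_split_ord /= addrAC subrr add0r.
rewrite trace_dot big_split_ord /=.
have D i : dot (A 'e_i) 'e_i ^+ 2 <= dot (A (A 'e_i)) 'e_i.
  rewrite [leRHS]As dot_delta /dot (bigD1 i) //= -expr2 lerDl.
  by apply: sumr_ge0 => k _; rewrite -expr2 sqr_ge0.
apply: lerD; rewrite ler_pdivrMr ?ltr0n // mulrC; apply: (le_trans (sum_sqr_ge _));
  by rewrite ler_wpM2l ?ler0n //; apply: ler_sum => i _; apply: D.
Qed.

Variables J1 J2 J3 : V -> V.
Definition orthogonal_structure (g : V -> V -> R) (J : V -> V) :=
  [/\ linear J, forall x, J (J x) = - x, forall x y, g (J x) (J y) = g x y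
    & forall x, lsubmx x = 0 -> lsubmx (J x) = 0].

Lemma structure_skew g J x y : inner_product g -> orthogonal_structure g J ->
  g (J x) y = - g x (J y).
Proof.
by move=> gI' [JL J2' Jg _]; rewrite -[LHS]Jg J2' (linN (ipl gI' _)).
Qed.

(** J Ric J T = J (Ric T J) is conjugate to (Ric T J) J = - Ric T. *)
Lemma trace_sandwich J (T : V -> V) : orthogonal_structure (@dot R _) J ->
  linear T -> (forall x, J (T x) = T (J x)) ->
  trace (J \o Ric \o J \o T) = - trace (Ric \o T).
Proof.
move=> [JL JJ _ _] TL JT.
have -> : - trace (Ric \o T) = trace (Ric \o T \o J \o J).
  rewrite !trace_dot -sumrN; apply: eq_bigr => i _ /=.
  by rewrite JJ (linN TL) (linN RicL) dotNl.
have JB : bijective J by exists (fun x => - J x) => x; rewrite ?(linN JL) JJ opprK.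
symmetry; apply: (trace_conj _ _ JL JB) => [a u v|a u v|x] /=.
- by rewrite !JL TL RicL.
- by rewrite TL JL RicL JL.
- by rewrite JT.
Qed.

(** Being skew and preserving the second summand, [J] also preserves its orthogonal complement,
    hence commutes with the projection. *)
Lemma structure_left J x : orthogonal_structure (@dot R _) J ->
  J (left_part x) = left_part (J x).
Proof.
move=> JO; have [JL JJ Jg Jr] := JO.
have Jl y : rsubmx (J (left_part y)) = 0.
  apply/dot_inj => z; rewrite dot0l.
  have -> : dot (rsubmx (J (left_part y))) z = dot (J (left_part y)) (row_mx 0 z).
    by rewrite -[J _ in RHS]hsubmxK dot_row_mx dot0r add0r.
  rewrite structure_skew // /left_part -[J (row_mx 0 z)]hsubmxK Jr ?row_mxKl //.
  by rewrite dot_row_mx dot0r dot0l addr0 oppr0.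
have xE : x = left_part x + row_mx 0 (rsubmx x).
  by rewrite /left_part add_row_mx addr0 add0r hsubmxK.
have R0 : left_part (J (row_mx 0 (rsubmx x))) = 0.
  by rewrite /left_part Jr ?row_mxKl // row_mx0.
rewrite {2}xE (linD JL) (linD left_part_linear) R0 addr0.
by rewrite -[LHS]hsubmxK Jl.
Qed.

Hypotheses (O1 : orthogonal_structure (@dot R _) J1)
  (O2 : orthogonal_structure (@dot R _) J2) (O3 : orthogonal_structure (@dot R _) J3).
Let A := invariant_ricci mu (@dot R _) J1 J2 J3.

Lemma invariant_ricci_dot_linear : linear A.
Proof. by case: O1 O2 O3 => L1 _ _ _ [L2 _ _ _] [L3 _ _ _]; exact: invariant_ricci_linear. Qed.

Lemma invariant_ricci_dot_sym x y : dot (A x) y = dot x (A y).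
Proof.
rewrite /A /invariant_ricci -/Ric dotZl dotZr; congr (_ * _).
rewrite !dotBl !dotBr.
have sk J u v : orthogonal_structure (@dot R _) J -> dot (J u) v = - dot u (J v).
  exact: structure_skew.
have sw J : orthogonal_structure (@dot R _) J ->
    dot (J (Ric (J x))) y = dot x (J (Ric (J y))).
  by move=> O; rewrite (sk J) // ricci_sym (sk J) // opprK.
by rewrite ricci_sym (sw J1) // (sw J2) // (sw J3).
Qed.

Lemma trace_invariant_ricci (T : V -> V) : linear T ->
  (forall J x, orthogonal_structure (@dot R _) J -> J (T x) = T (J x)) ->
  trace (A \o T) = trace (Ric \o T).
Proof.
move=> TL JT.
transitivity (4^-1 * (trace (Ric \o T) - trace (J1 \o Ric \o J1 \o T)
    - trace (J2 \o Ric \o J2 \o T) - trace (J3 \o Ric \o J3 \o T))).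
  rewrite !trace_dot -!sumrB mulr_sumr; apply: eq_bigr => i _ /=.
  by rewrite dotZl !dotBl.
by rewrite !trace_sandwich //; [field | move=> x; apply: JT..].
Qed.

(** The traces 2 sc on dimension m and - sc on dimension n give (2 sc)^2 / m + sc^2 / n. *)
Lemma ricci_gamma_sq_ge_dot : (0 < m)%N -> (0 < n)%N ->
  (4 / m%:R + n%:R^-1) * scalar_curvature mu (@dot R _) ^+ 2
    <= ricci_gamma_sq mu J1 J2 J3 (@dot R _).
Proof.
move=> m0 n0; have alg (x y sc q : R) : x = - 4^-1 * S -> y = - 2^-1 * S -> sc = - 4^-1 * S ->
    y ^+ 2 / m%:R + (x - y) ^+ 2 / n%:R <= q -> (4 / m%:R + n%:R^-1) * sc ^+ 2 <= q.
  move=> -> -> -> h; apply: le_trans h; rewrite le_eqVlt; apply/orP; left; apply/eqP; field.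
  by rewrite !pnatr_eq0 -!lt0n n0 m0.
have tl := trace_invariant_ricci left_part_linear (fun J x => structure_left x (J := J)).
have ta : trace (A \o id) = trace (Ric \o id) by exact: trace_invariant_ricci.
exact: (alg _ _ _ _ (etrans ta trace_ricci) (etrans tl trace_ricci_left) trace_ricci
  (trace_sqr_ge m0 n0 invariant_ricci_dot_linear invariant_ricci_dot_sym)).
Qed.

End StandardMetric.

(** Everything is transported along the [P] of [inner_product_dot]. Since [P] and its inverse
    preserve the second summand, the transported bracket is again adapted and the transported J_i
    still preserve that summand, even when the two summands are not orthogonal for [g]. *)
Lemma ricci_gamma_sq_ge mu J1 J2 J3 g : (0 < m)%N -> (0 < n)%N -> adapted mu ->
  inner_product g -> orthogonal_structure g J1 -> orthogonal_structure g J2 ->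
  orthogonal_structure g J3 ->
  (4 / m%:R + n%:R^-1) * scalar_curvature mu g ^+ 2
    <= ricci_gamma_sq mu J1 J2 J3 g.
Proof.
move=> m0 n0 muA gI O1 O2 O3.
have [P [PL [Q PQ QP] Pg Pl]] := inner_product_dot gI.
have PB : bijective P by exists Q.
have QL : linear Q by move=> a u v; apply: (can_inj PQ); rewrite PL !QP.
have Ql x : lsubmx x = 0 -> lsubmx (Q x) = 0.
  by move=> x0; rewrite Pl QP.
pose c (J : V -> V) x := P (J (Q x)).
pose nu x y := P (mu (Q x) (Q y)).
have muB : bilinear_map mu by case: muA.
have nuA : adapted nu.
  case: muA => -[L1 L2] h0 hl hr; split.
  - by split=> [v|v] a x y; rewrite /nu !(QL, L1, L2, PL).
  - by move=> x; rewrite /nu h0 (lin0 PL).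
  - by move=> x y; rewrite -Pl.
  - by move=> x z z0; rewrite /nu hr ?(lin0 PL) // Ql.
have nuB : bilinear_map nu by case: nuA.
have cO J : orthogonal_structure g J -> orthogonal_structure (@dot R _) (c J).
  case=> JL JJ Jg Jl; split.
  - by move=> a u v; rewrite /c !(QL, JL, PL).
  - by move=> x; rewrite /c PQ JJ (linN PL) QP.
  - by move=> x y; rewrite /c Pg Jg -Pg !QP.
  - by move=> x x0; rewrite -Pl; apply/Jl/Ql.
have Pric x : P (ricci mu g x) = ricci nu (@dot R _) (P x).
  by apply: ricci_natural => //; [exact: dot_inner | move=> u v; rewrite /nu !PQ].
have RL := ricci_linear gI muB.
have RL' := ricci_linear (@dot_inner R (m + n)) nuB.
have -> : scalar_curvature mu g = scalar_curvature nu (@dot R _).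
  exact: (trace_conj RL RL' PL PB Pric).
have Pinv x : P (invariant_ricci mu g J1 J2 J3 x) =
    invariant_ricci nu (@dot R _) (c J1) (c J2) (c J3) (P x).
  by rewrite /invariant_ricci (linZ PL) !(linB PL) /c !PQ Pric -!Pric !PQ.
have AL : linear (invariant_ricci mu g J1 J2 J3).
  by case: O1 O2 O3 => L1 _ _ _ [L2 _ _ _] [L3 _ _ _]; exact: invariant_ricci_linear.
have -> : ricci_gamma_sq mu J1 J2 J3 g =
    ricci_gamma_sq nu (c J1) (c J2) (c J3) (@dot R _).
  have AL' := invariant_ricci_dot_linear nuA (cO _ O1) (cO _ O2) (cO _ O3).
  have sq (B : V -> V) : linear B -> linear (B \o B).
    by move=> BL a u v; rewrite /= !BL.
  by apply: (trace_conj (sq _ AL) (sq _ AL') PL PB) => x; rewrite /= !Pinv.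
by apply: ricci_gamma_sq_ge_dot => //; apply: cO.
Qed.

End Minimality.

(** * The brackets mu_t *)

Section Coordinates.
Variable R : realType.
Notation V := 'rV[R]_(4 + 4).

(** With explicit coordinates the identities about [mu] and the J_i become polynomial and fall to
    [ring]. *)
Definition rv4 (a b c d : R) : 'rV[R]_4 := \row_i [:: a; b; c; d]`_i.

Lemma ord4P (P : 'I_4 -> Prop) :
  P (inord 0) -> P (inord 1) -> P (inord 2) -> P (inord 3) -> forall i, P i.
Proof.
move=> h0 h1 h2 h3 k; rewrite -[k]inord_val.
by case: k => -[|[|[|[|?]]]] ?.
Qed.

Lemma co_rv4 a b c d : [/\ co 1 (rv4 a b c d) = a, co 2 (rv4 a b c d) = b,
  co 3 (rv4 a b c d) = c & co 4 (rv4 a b c d) = d].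
Proof. by rewrite /co !mxE !inordK. Qed.

Lemma rv4P (x : 'rV[R]_4) : exists a b c d, x = rv4 a b c d.
Proof.
exists (co 1 x), (co 2 x), (co 3 x), (co 4 x).
by apply/rowP; apply: ord4P; rewrite mxE inordK.
Qed.

Lemma rv8P (x : V) : exists a b c d a' b' c' d',
  x = row_mx (rv4 a b c d) (rv4 a' b' c' d').
Proof.
have [a [b [c [d hl]]]] := rv4P (lsubmx x).
have [a' [b' [c' [d' hr]]]] := rv4P (rsubmx x).
by exists a, b, c, d, a', b', c', d'; rewrite -hl -hr hsubmxK.
Qed.

Lemma rv4D a b c d a' b' c' d' :
  rv4 a b c d + rv4 a' b' c' d' = rv4 (a + a') (b + b') (c + c') (d + d').
Proof. by apply/rowP; apply: ord4P; rewrite !mxE !inordK. Qed.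
Lemma rv4N a b c d : - rv4 a b c d = rv4 (- a) (- b) (- c) (- d).
Proof. by apply/rowP; apply: ord4P; rewrite !mxE !inordK. Qed.
Lemma rv4Z k a b c d : k *: rv4 a b c d = rv4 (k * a) (k * b) (k * c) (k * d).
Proof. by apply/rowP; apply: ord4P; rewrite !mxE !inordK. Qed.
Lemma rv40 : 0 = rv4 0 0 0 0.
Proof. by apply/rowP; apply: ord4P; rewrite !mxE !inordK. Qed.

Lemma big4 (W : nmodType) (F : 'I_4 -> W) :
  \sum_i F i = F (inord 0) + F (inord 1) + F (inord 2) + F (inord 3).
Proof.
rewrite !big_ord_recr big_ord0 /= add0r.
by do 3?congr (_ + _); congr F; apply: val_inj; rewrite /= inordK.
Qed.

Lemma dot_rv4 a b c d a' b' c' d' :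
  dot (rv4 a b c d) (rv4 a' b' c' d') = a * a' + b * b' + c * c' + d * d'.
Proof. by rewrite /dot big4 !mxE !inordK. Qed.

Lemma e_rv4 : [/\ e R 1 = rv4 1 0 0 0, e R 2 = rv4 0 1 0 0, e R 3 = rv4 0 0 1 0
  & e R 4 = rv4 0 0 0 1].
Proof.
by split; apply/rowP; apply: ord4P; rewrite !mxE !inordK //= -val_eqE /= !inordK.
Qed.

Lemma rv4_inj a b c d a' b' c' d' : rv4 a b c d = rv4 a' b' c' d' ->
  [/\ a = a', b = b', c = c' & d = d'].
Proof.
move=> E; have := co_rv4 a' b' c' d'; rewrite -E.
by have [-> -> -> ->] := co_rv4 a b c d.
Qed.

Lemma j1_rv4 a b c d : j1 (rv4 a b c d) = rv4 (- b) a (- d) c.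
Proof.
rewrite /j1; have [-> -> -> ->] := co_rv4 a b c d; have [-> -> -> ->] := e_rv4.
by rewrite !(rv4Z, rv4N, rv4D); congr rv4; ring.
Qed.

Lemma j2_rv4 a b c d : j2 (rv4 a b c d) = rv4 (- c) d a (- b).
Proof.
rewrite /j2; have [-> -> -> ->] := co_rv4 a b c d; have [-> -> -> ->] := e_rv4.
by rewrite !(rv4Z, rv4N, rv4D); congr rv4; ring.
Qed.

(** The Z-coordinates of [mu t], with s standing for the square root so that algebraic identities do
    not see it. The first form is anti-self-dual on R^4 with its standard orientation, the other
    three are self-dual. *)
Definition omega s t (a b c d a' b' c' d' : R) : 'rV[R]_4 :=
  rv4 (s * ((a * b' - b * a') - (c * d' - d * c')))
      (t * ((a * b' - b * a') + (c * d' - d * c')))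
      (t * ((a * c' - c * a') - (b * d' - d * b')))
      (t * ((a * d' - d * a') + (b * c' - c * b'))).

Lemma mu_rv4 t a b c d a' b' c' d' z z' :
  mu t (row_mx (rv4 a b c d) z) (row_mx (rv4 a' b' c' d') z')
  = row_mx 0 (omega (Num.sqrt (1 - 3 * t ^+ 2)) t a b c d a' b' c' d').
Proof.
rewrite /mu /wedge !row_mxKl.
have [-> -> -> ->] := co_rv4 a b c d; have [-> -> -> ->] := co_rv4 a' b' c' d'.
rewrite /Z; have [-> -> -> ->] := e_rv4.
rewrite !(scale_row_mx, add_row_mx, rv40, rv4Z, rv4D) /omega.
by congr row_mx; congr rv4; ring.
Qed.

Lemma j_linear : linear (@j1 R) /\ linear (@j2 R).
Proof.
by split=> k x y; have [a [b [c [d ->]]]] := rv4P x;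
  have [a' [b' [c' [d' ->]]]] := rv4P y;
  rewrite !(j1_rv4, j2_rv4, rv4Z, rv4D); congr rv4; ring.
Qed.

Lemma J1_rv4 a b c d a' b' c' d' :
  J1 (row_mx (rv4 a b c d) (rv4 a' b' c' d'))
  = row_mx (rv4 (- b) a (- d) c) (rv4 (- b') a' (- d') c').
Proof. by rewrite /J1 row_mxKl row_mxKr !j1_rv4. Qed.

Lemma J2_rv4 a b c d a' b' c' d' :
  J2 (row_mx (rv4 a b c d) (rv4 a' b' c' d'))
  = row_mx (rv4 (- c) d a (- b)) (rv4 (- c') d' a' (- b')).
Proof. by rewrite /J2 row_mxKl row_mxKr !j2_rv4. Qed.

Lemma J3_rv4 a b c d a' b' c' d' :
  J3 (row_mx (rv4 a b c d) (rv4 a' b' c' d'))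
  = row_mx (rv4 (- d) (- c) b a) (rv4 (- d') (- c') b' a').
Proof. by rewrite /J3 J2_rv4 J1_rv4 !opprK. Qed.

Definition J_rv4 := (J1_rv4, J2_rv4, J3_rv4).

Lemma J_linear : [/\ linear (@J1 R), linear (@J2 R) & linear (@J3 R)].
Proof.
have [l1 l2] := j_linear.
have L1 : linear (@J1 R).
  by move=> k x y; rewrite /J1 !linearP /= !l1 scale_row_mx add_row_mx.
have L2 : linear (@J2 R).
  by move=> k x y; rewrite /J2 !linearP /= !l2 scale_row_mx add_row_mx.
by split=> // k x y; rewrite /J3 L2 L1.
Qed.

Lemma mu_adapted (t : R) : adapted (mu t).
Proof.
have [b h _] := mu_lie_bracket t; split=> //; first exact: lsubmx_mu.
move=> x z; have [a' [b' [c' [d' [? [? [? [? ->]]]]]]]] := rv8P x.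
rewrite -[z]hsubmxK row_mxKl => ->; rewrite rv40 mu_rv4 -row_mx0; congr row_mx.
by rewrite rv40; congr rv4; ring.
Qed.

Lemma J_orthogonal :
  [/\ orthogonal_structure (@ip R) (@J1 R), orthogonal_structure (@ip R) (@J2 R)
    & orthogonal_structure (@ip R) (@J3 R)].
Proof.
have [L1 L2 L3] := J_linear.
by split; split=> // [x|x y|x]; try have [a2 [b2 [c2 [d2 [a3 [b3 [c3 [d3 ->]]]]]]]] := rv8P y;
  have [a [b [c [d [a' [b' [c' [d' ->]]]]]]]] := rv8P x;
  rewrite !J_rv4 ?opp_row_mx ?rv4N ?opprK //;
  first [rewrite ![ip _ _]dot_row_mx !dot_rv4; ring
  |rewrite !row_mxKl rv40 => /rv4_inj[-> -> -> ->]; rewrite oppr0].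
Qed.

Lemma J_quaternion (x : V) : J1 (J2 x) = J3 x /\ J3 x = - J2 (J1 x).
Proof.
split=> //; have [a [b [c [d [a' [b' [c' [d' ->]]]]]]]] := rv8P x.
by rewrite !J_rv4 opp_row_mx !rv4N !opprK.
Qed.

Lemma mu_hypercomplex (t : R) : hypercomplex (mu t) (@J1 R) (@J2 R) (@J3 R).
Proof.
have [[L1 S1 _ _] [L2 S2 _ _] [L3 S3 _ _]] := J_orthogonal.
split=> //; first exact: J_quaternion.
by move=> J HJ x y; have [a [b [c [d [a' [b' [c' [d' ->]]]]]]]] := rv8P x;
  have [a2 [b2 [c2 [d2 [a3 [b3 [c3 [d3 ->]]]]]]]] := rv8P y;
  case: HJ => ->; rewrite !J_rv4 !mu_rv4 /omega rv40 !J_rv4 !add_row_mx !rv4D;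
  congr row_mx; congr rv4; ring.
Qed.

(** For t = 0 only x1 y2 - x2 y1 - (x3 y4 - x4 y3) remains, which all three J_i leave invariant, so
    the structure is abelian at this endpoint. Conversely J_2 X_1 = X_3 and J_2 X_2 = - X_4, and the
    Z_2-components of the two brackets give - t = t. *)
Lemma mu_abelian (t : R) :
  abelian_hypercomplex (mu t) (@J1 R) (@J2 R) (@J3 R) <-> t = 0.
Proof.
split=> [h|-> J HJ x y].
  have := h (@J2 R) (Or32 _ _ erefl) (row_mx (rv4 1 0 0 0) 0) (row_mx (rv4 0 1 0 0) 0).
  rewrite rv40 !J_rv4 !mu_rv4 /omega => /eq_row_mx[_ /rv4_inj[_]].
  by rewrite !(mul0r, mulr0, mulr1, subr0, sub0r, mulrN, mul1r, addr0) => ? _ _; lra.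
by have [a [b [c [d [a' [b' [c' [d' ->]]]]]]]] := rv8P x;
  have [a2 [b2 [c2 [d2 [a3 [b3 [c3 [d3 ->]]]]]]]] := rv8P y;
  case: HJ => ->; rewrite !J_rv4 !mu_rv4 /omega; congr row_mx; congr rv4; ring.
Qed.

Lemma sum_mu_delta (W : nmodType) (F : V -> W) (t : R) : F 0 = 0 ->
  forall x, \sum_i F (mu t x 'e_i) = \sum_(k < 4) F (mu t x (row_mx 'e_k 0)).
Proof.
move=> F0 x; rewrite big_split_ord /= [X in _ + X]big1 ?addr0 => [|k _].
  by apply: eq_bigr => k _; rewrite delta_mx_lshift.
have A := mu_adapted t; rewrite (nil2_anti 'e__ _ (adapted_nil2 A)); case: A => _ _ _ ->.
  by rewrite oppr0.
by rewrite delta_mx_rshift row_mxKl.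
Qed.

Lemma delta_rv4 : [/\ 'e_(inord 0) = rv4 1 0 0 0, 'e_(inord 1) = rv4 0 1 0 0,
  'e_(inord 2) = rv4 0 0 1 0 & 'e_(inord 3) = rv4 0 0 0 1].
Proof. exact: e_rv4. Qed.

Lemma mu_ricci (t : R) a b c d a' b' c' d' : 3 * t ^+ 2 <= 1 ->
  ricci (mu t) (@ip R) (row_mx (rv4 a b c d) (rv4 a' b' c' d')) =
  row_mx (- 2^-1 *: rv4 a b c d)
    (rv4 ((1 - 3 * t ^+ 2) * a') (t ^+ 2 * b') (t ^+ 2 * c') (t ^+ 2 * d')).
Proof.
move=> t1; have A := mu_adapted t; have B : bilinear_map (mu t) by case: A.
apply: dot_inj => y; rewrite -[ip (R:=R)]/(@dot R (4 + 4)).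
rewrite ricciE ?ricci_formE //; last exact: dot_inner.
have -> : \sum_i \sum_k dot (mu t 'e_i 'e_k) (row_mx (rv4 a b c d) (rv4 a' b' c' d'))
      * dot (mu t 'e_i 'e_k) y =
    \sum_(i < 4) \sum_(k < 4) dot (mu t (row_mx 'e_i 0) (row_mx 'e_k 0))
      (row_mx (rv4 a b c d) (rv4 a' b' c' d')) * dot (mu t (row_mx 'e_i 0) (row_mx 'e_k 0)) y.
  rewrite big_split_ord /= [X in _ + X]big1 ?addr0 => [|k _].
    apply: eq_bigr => k _; rewrite delta_mx_lshift.
    by rewrite (@sum_mu_delta _ (fun u => dot u _ * dot u _)) // dot0l mul0r.
  case: A => _ _ _ c0; apply: big1 => l _; rewrite c0 ?dot0l ?mul0r //.
  by rewrite delta_mx_rshift row_mxKl.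
have -> : \sum_i dot (mu t (row_mx (rv4 a b c d) (rv4 a' b' c' d')) 'e_i) (mu t y 'e_i) =
  \sum_(k < 4) dot (mu t (row_mx (rv4 a b c d) (rv4 a' b' c' d')) (row_mx 'e_k 0))
    (mu t y (row_mx 'e_k 0)).
  rewrite big_split_ord /= [X in _ + X]big1 ?addr0 => [|k _].
    by apply: eq_bigr => k _; rewrite delta_mx_lshift.
  rewrite (nil2_anti 'e__ _ (adapted_nil2 A)); case: A => _ _ _ ->; first by rewrite oppr0 dot0l.
  by rewrite delta_mx_rshift row_mxKl.
have [a2 [b2 [c2 [d2 [a3 [b3 [c3 [d3 ->]]]]]]]] := rv8P y.
rewrite !big4; have [-> -> -> ->] := delta_rv4; rewrite !mu_rv4 /omega rv40.
rewrite rv4Z !dot_row_mx !dot_rv4.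
set s := Num.sqrt _; have s2 : s ^+ 2 = 1 - 3 * t ^+ 2 by rewrite sqr_sqrtr ?subr_ge0.
have -> : 1 - 3 * t ^+ 2 = s ^+ 2 by [].
(* The Ricci operator on n1 is - (s^2 + 3 t^2) / 2; the normalization s^2 + 3 t^2 = 1 makes it
   independent of t. *)
rewrite (_ : - 2^-1 = - 2^-1 * (s ^+ 2 + 3 * t ^+ 2)); first by field.
by rewrite s2 subrK mulr1.
Qed.

End Coordinates.

Section CurveGeometry.
Variable R : realType.
Notation V := 'rV[R]_(4 + 4).

Lemma sqr_bound (t : R) : 0 <= t <= (Num.sqrt 3)^-1 -> 3 * t ^+ 2 <= 1.
Proof.
move=> /andP[t0 t1]; have s3 : 0 < Num.sqrt 3 :> R by rewrite sqrtr_gt0.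
have : t ^+ 2 <= (Num.sqrt 3)^-1 ^+ 2 by apply: lerXn2r => //; rewrite nnegrE ?invr_ge0 ?(ltW s3).
rewrite exprVn sqr_sqrtr ?ler0n //. by move=> ?; lra.
Qed.

Lemma trace8 (f : V -> V) : trace f =
  (dot (f (row_mx (rv4 1 0 0 0) 0)) (row_mx (rv4 1 0 0 0) 0)
  + dot (f (row_mx (rv4 0 1 0 0) 0)) (row_mx (rv4 0 1 0 0) 0)
  + dot (f (row_mx (rv4 0 0 1 0) 0)) (row_mx (rv4 0 0 1 0) 0)
  + dot (f (row_mx (rv4 0 0 0 1) 0)) (row_mx (rv4 0 0 0 1) 0))
  + (dot (f (row_mx 0 (rv4 1 0 0 0))) (row_mx 0 (rv4 1 0 0 0))
  + dot (f (row_mx 0 (rv4 0 1 0 0))) (row_mx 0 (rv4 0 1 0 0))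
  + dot (f (row_mx 0 (rv4 0 0 1 0))) (row_mx 0 (rv4 0 0 1 0))
  + dot (f (row_mx 0 (rv4 0 0 0 1))) (row_mx 0 (rv4 0 0 0 1))).
Proof.
rewrite trace_dot big_split_ord /= !big4 !delta_mx_lshift !delta_mx_rshift.
by have [-> -> -> ->] := @delta_rv4 R.
Qed.

Section Fixed.
Variable t : R.
Hypothesis t1 : 3 * t ^+ 2 <= 1.

Lemma mu_scalar_curvature : scalar_curvature (mu t) (@ip R) = -1.
Proof.
rewrite /scalar_curvature trace8 rv40 !mu_ricci // !rv4Z !dot_row_mx !dot_rv4.
by field.
Qed.

(** Up to sign the J_i carry each Z_k to all the others, so averaging replaces the four eigenvalues
    on n2 by their mean 1/4. *)
Lemma mu_invariant_ricci a b c d a' b' c' d' :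
  invariant_ricci (mu t) (@ip R) (@J1 R) (@J2 R) (@J3 R)
    (row_mx (rv4 a b c d) (rv4 a' b' c' d'))
  = row_mx (- 2^-1 *: rv4 a b c d) (4^-1 *: rv4 a' b' c' d').
Proof.
rewrite /invariant_ricci !J_rv4 !mu_ricci // !rv4Z !J_rv4.
rewrite !(opp_row_mx, rv4N, add_row_mx, rv4D, scale_row_mx, rv4Z).
by congr row_mx; congr rv4; field.
Qed.

(** 4 (1/2)^2 + 4 (1/4)^2 is exactly the bound of [ricci_gamma_sq_ge] for m = n = 4 and scalar
    curvature -1. *)
Lemma mu_ricci_gamma_sq :
  ricci_gamma_sq (mu t) (@J1 R) (@J2 R) (@J3 R) (@ip R) = 5 / 4.
Proof.
rewrite /ricci_gamma_sq trace8 /= rv40 !mu_invariant_ricci !rv4Z.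
rewrite !mu_invariant_ricci !rv4Z !dot_row_mx !dot_rv4.
by field.
Qed.

Lemma mu_minimal : minimal_metric (mu t) (@J1 R) (@J2 R) (@J3 R) (@ip R).
Proof.
have [[L1 S1 O1 P1] [L2 S2 O2 P2] [L3 S3 O3 P3]] := J_orthogonal R.
split=> [|g [gI gJ] gs].
  split; first exact: (@dot_inner R (4 + 4)).
  by move=> J [] ->.
have := @ricci_gamma_sq_ge R 4 4 (mu t) (@J1 R) (@J2 R) (@J3 R) g isT isT (mu_adapted t) gI.
rewrite gs mu_scalar_curvature mu_ricci_gamma_sq => h.
apply: le_trans (h _ _ _); first by rewrite le_eqVlt; apply/orP; left; apply/eqP; field.
- by split=> // x y; apply: gJ; constructor 1.
- by split=> // x y; apply: gJ; constructor 2.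
- by split=> // x y; apply: gJ; constructor 3.
Qed.

End Fixed.

(** Here u and v are the squared parameters. The second power sum leaves the alternative u + v =
    1/2, which does occur for distinct u, v in [0, 1/3]; the third one excludes it. *)
Lemma power_sums_inj (u v : R) :
  1 + (1 - 3 * u) ^+ 2 + 3 * u ^+ 2 = 1 + (1 - 3 * v) ^+ 2 + 3 * v ^+ 2 ->
  - 2^-1 + (1 - 3 * u) ^+ 3 + 3 * u ^+ 3 = - 2^-1 + (1 - 3 * v) ^+ 3 + 3 * v ^+ 3 ->
  u = v.
Proof.
move=> /eqP; rewrite -subr_eq0 => /eqP E2 /eqP; rewrite -subr_eq0 => /eqP E3.
have F2 : 6 * ((u - v) * (2 * (u + v) - 1)) = 0 by rewrite -[RHS]E2; ring.
have F3 : (u - v) * (- 9 + 27 * (u + v) - 24 * (u ^+ 2 + u * v + v ^+ 2)) = 0.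
  by rewrite -[RHS]E3; ring.
apply/eqP; apply: contraT; rewrite -subr_eq0 => uv0.
have vE : v = 2^-1 - u.
  move/eqP: F2; rewrite !mulf_eq0 (negPf uv0) pnatr_eq0 /= => /eqP F2; lra.
move/eqP: F3; rewrite mulf_eq0 (negPf uv0) => /eqP; rewrite vE => F3.
(* On the line u + v = 1/2 the cofactor of u - v in the cubic equation equals - 6 (u - v)^2. *)
have : (u - v) ^+ 2 = 0 by rewrite vE -[RHS](mulr0 (- 6)^-1) -[in RHS]F3; field.
by move/eqP; rewrite sqrf_eq0 (negPf uv0).
Qed.

(* Ric_t has the eigenvalues -1/2 (four times), 1 - 3 t^2 and t^2 (three times), which the traces of its square and cube determine. *)
Lemma ricci_rigidity (s t : R) (P : V -> V) :
  0 <= s <= (Num.sqrt 3)^-1 -> 0 <= t <= (Num.sqrt 3)^-1 ->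
  linear P -> bijective P ->
  (forall x, P (ricci (mu s) (@ip R) x) = ricci (mu t) (@ip R) (P x)) -> s = t.
Proof.
move=> hs ht PL PB h; have s1 := sqr_bound hs; have t1 := sqr_bound ht.
have gI : inner_product (@ip R) := @dot_inner R (4 + 4).
have RL (r : R) : linear (ricci (mu r) (@ip R)).
  by apply: ricci_linear => //; case: (mu_adapted r).
pose r2 (r : R) := ricci (mu r) (@ip R) \o ricci (mu r) (@ip R).
have E2 : trace (r2 s) = trace (r2 t).
  by apply: (trace_conj _ _ PL PB) => [a u v|a u v|x]; rewrite /r2 /= ?RL ?h.
pose r3 (r : R) := ricci (mu r) (@ip R) \o r2 r.
have E3 : trace (r3 s) = trace (r3 t).
  by apply: (trace_conj _ _ PL PB) => [a u v|a u v|x]; rewrite /r3 /r2 /= ?RL ?h.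
have T2 (r : R) : 3 * r ^+ 2 <= 1 ->
    trace (r2 r) = 1 + (1 - 3 * r ^+ 2) ^+ 2 + 3 * (r ^+ 2) ^+ 2.
  move=> r1; rewrite trace8 /r2 /= rv40 !(mu_ricci _ _ _ _ _ _ _ _ r1) !rv4Z.
  rewrite !(mu_ricci _ _ _ _ _ _ _ _ r1) !rv4Z !dot_row_mx !dot_rv4; by field.
have T3 (r : R) : 3 * r ^+ 2 <= 1 ->
    trace (r3 r) = - 2^-1 + (1 - 3 * r ^+ 2) ^+ 3 + 3 * (r ^+ 2) ^+ 3.
  move=> r1; rewrite trace8 /r3 /r2 /= rv40 !(mu_ricci _ _ _ _ _ _ _ _ r1) !rv4Z.
  rewrite !(mu_ricci _ _ _ _ _ _ _ _ r1) !rv4Z.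
  rewrite !(mu_ricci _ _ _ _ _ _ _ _ r1) !rv4Z !dot_row_mx !dot_rv4; by field.
have /andP[s0 _] := hs; have /andP[t0 _] := ht.
have st := power_sums_inj (etrans (esym (T2 _ s1)) (etrans E2 (T2 _ t1)))
  (etrans (esym (T3 _ s1)) (etrans E3 (T3 _ t1))).
by have := eqrXn2 (ltn0Sn 1) s0 t0; rewrite st eqxx => /esym/eqP.
Qed.

End CurveGeometry.

(** * Hypercomplex isomorphisms *)

Section HypercomplexRigidity.
Variable R : realType.
Notation V := 'rV[R]_(4 + 4).

Lemma dot_isometry_bij n (P : 'rV[R]_n -> 'rV[R]_n) : linear P ->
  (forall x y, dot (P x) (P y) = dot x y) -> bijective P.
Proof.
move=> PL Pd; pose M := lin1_mx P.
have PM x : P x = x *m M by exact: lin1_mxE.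
have MM : M *m M^T = 1%:M.
  apply/row_matrixP=> i; apply: dot_inj => z.
  by rewrite !rowE mulmx1 mulmxA dot_mulmx trmxK -!PM Pd.
exists (mulmx^~ M^T) => x; rewrite PM -mulmxA ?MM ?mulmx1 //.
by rewrite (mulmx1C MM) mulmx1.
Qed.

(** With e_1, ..., e_4 read as 1, i, j, k, the maps [j1] and [j2] are left multiplications by i and
    j. A map commuting with them is right multiplication by the image of 1, and rho is the squared
    norm of that quaternion. *)
Lemma quaternionic_similarity (a : 'rV[R]_4 -> 'rV[R]_4) : linear a ->
  (forall x, a (j1 x) = j1 (a x)) -> (forall x, a (j2 x) = j2 (a x)) ->
  exists2 rho, 0 <= rho & forall x y, dot (a x) (a y) = rho * dot x y.
Proof.
move=> aL a1 a2; have [p [q [r [w E1]]]] := rv4P (a (rv4 1 0 0 0)).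
have E2 : a (rv4 0 1 0 0) = rv4 (- q) p (- w) r.
  by rewrite -j1_rv4 -E1 -a1 j1_rv4 !oppr0.
have E3 : a (rv4 0 0 1 0) = rv4 (- r) w p (- q).
  by rewrite -j2_rv4 -E1 -a2 j2_rv4 !oppr0.
have E4 : a (rv4 0 0 0 1) = rv4 (- w) (- r) q p.
  by rewrite -[q in RHS]opprK -j1_rv4 -E3 -a1 j1_rv4 !oppr0.
have aE x y z u : a (rv4 x y z u) =
    x *: a (rv4 1 0 0 0) + y *: a (rv4 0 1 0 0) + z *: a (rv4 0 0 1 0) + u *: a (rv4 0 0 0 1).
  rewrite -!(linZ aL) -!(linD aL) !(rv4Z, rv4D).
  by rewrite !(mulr0, mulr1, addr0, add0r).
exists (p ^+ 2 + q ^+ 2 + r ^+ 2 + w ^+ 2); first by rewrite !addr_ge0 ?sqr_ge0.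
move=> x y; have [x1 [x2 [x3 [x4 ->]]]] := rv4P x; have [y1 [y2 [y3 [y4 ->]]]] := rv4P y.
rewrite (aE x1) (aE y1) E1 E2 E3 E4 !(rv4Z, rv4D) !dot_rv4; ring.
Qed.

Lemma ricci_scale (mu : V -> V -> V) (c : R) x : adapted mu ->
  ricci (fun x y => c *: mu x y) (@dot R _) x = c ^+ 2 *: ricci mu (@dot R _) x.
Proof.
move=> A; have A' : adapted (fun x y => c *: mu x y).
  case: A => -[L1 L2] h0 h1 h2; split=> [|u|u v|u v v0].
  - split=> [v|v] k u w /=.
    + by rewrite (L1 v k u w) scalerDr !scalerA mulrC.
    + by rewrite (L2 v k u w) scalerDr !scalerA mulrC.
  - by rewrite h0 scaler0.
  - by rewrite linearZ /= h1 scaler0.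
  - by rewrite h2 // scaler0.
have gI := @dot_inner R (4 + 4).
have [B _ _ _] := A; have [B' _ _ _] := A'.
apply: dot_inj => z; rewrite dotZl !ricciE // !ricci_formE //.
rewrite mulrBr; congr (_ - _).
  rewrite [RHS]mulrCA [in RHS]mulr_sumr; congr (_ * _); apply: eq_bigr => i _.
  by rewrite mulr_sumr; apply: eq_bigr => k _; rewrite !dotZl; ring.
rewrite [RHS]mulrCA [in RHS]mulr_sumr; congr (_ * _); apply: eq_bigr => i _.
by rewrite dotZl dotZr; ring.
Qed.

Lemma mu_left (t : R) (x x' y y' : V) : lsubmx x = lsubmx x' -> lsubmx y = lsubmx y' ->
  mu t x y = mu t x' y'.
Proof. by rewrite /mu /wedge => -> ->. Qed.

Lemma hypercomplex_rigidity (s t : R) :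
  0 <= s <= (Num.sqrt 3)^-1 -> 0 <= t <= (Num.sqrt 3)^-1 ->
  hypercomplex_isomorphic (mu s) (@J1 R) (@J2 R) (@J3 R)
    (mu t) (@J1 R) (@J2 R) (@J3 R) -> s = t.
Proof.
move=> hs ht [phi [[phiL phiM] [psi phiK psiK] [c1 c2 _]]].
have [l1 l2] := j_linear R.
have lJ1 x : lsubmx (J1 x) = j1 (lsubmx x :> 'rV[R]_4) by rewrite /J1 row_mxKl.
have lJ2 x : lsubmx (J2 x) = j2 (lsubmx x :> 'rV[R]_4) by rewrite /J2 row_mxKl.
have rJ1 x : rsubmx (J1 x) = j1 (rsubmx x :> 'rV[R]_4) by rewrite /J1 row_mxKr.
have rJ2 x : rsubmx (J2 x) = j2 (rsubmx x :> 'rV[R]_4) by rewrite /J2 row_mxKr.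
have J1l x : row_mx (j1 x) 0 = J1 (row_mx x 0) :> V.
  by rewrite /J1 row_mxKl row_mxKr (lin0 l1).
have J2l x : row_mx (j2 x) 0 = J2 (row_mx x 0) :> V.
  by rewrite /J2 row_mxKl row_mxKr (lin0 l2).
have J1r x : row_mx 0 (j1 x) = J1 (row_mx 0 x) :> V.
  by rewrite /J1 row_mxKl row_mxKr (lin0 l1).
have J2r x : row_mx 0 (j2 x) = J2 (row_mx 0 x) :> V.
  by rewrite /J2 row_mxKl row_mxKr (lin0 l2).
have rowl k (x y : 'rV[R]_4) : row_mx (k *: x + y) 0 = k *: row_mx x 0 + row_mx y 0 :> V.
  by rewrite scale_row_mx add_row_mx scaler0 addr0.
have rowr k (x y : 'rV[R]_4) : row_mx 0 (k *: x + y) = k *: row_mx 0 x + row_mx 0 y :> V.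
  by rewrite scale_row_mx add_row_mx scaler0 addr0.
pose a (x : 'rV[R]_4) : 'rV[R]_4 := lsubmx (phi (row_mx x 0)).
pose c (x : 'rV[R]_4) : 'rV[R]_4 := lsubmx (phi (row_mx 0 x)).
pose d (x : 'rV[R]_4) : 'rV[R]_4 := rsubmx (phi (row_mx 0 x)).
have aL : linear a by move=> k x y; rewrite /a rowl phiL linearP.
have cL : linear c by move=> k x y; rewrite /c rowr phiL linearP.
have dL : linear d by move=> k x y; rewrite /d rowr phiL linearP.
have [rc _ cE] : exists2 rho, 0 <= rho & forall x y, dot (c x) (c y) = rho * dot x y.
  by apply: quaternionic_similarity => // x; [rewrite /c J1r c1 lJ1|rewrite /c J2r c2 lJ2].
have [ra ra0 aE] : exists2 rho, 0 <= rho & forall x y, dot (a x) (a y) = rho * dot x y.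
  by apply: quaternionic_similarity => // x; [rewrite /a J1l c1 lJ1|rewrite /a J2l c2 lJ2].
have [rd rd0 dE] : exists2 rho, 0 <= rho & forall x y, dot (d x) (d y) = rho * dot x y.
  by apply: quaternionic_similarity => // x; [rewrite /d J1r c1 rJ1|rewrite /d J2r c2 rJ2].
(* [phi] maps brackets to brackets, so [c] kills a nonzero vector of n2; a similarity with a nonzero
   kernel is zero. Thus n2 is preserved even when the brackets do not span it. *)
have c0 x : c x = 0.
  have [_ [u [v uv]]] := mu_two_step t.
  have muE : mu t u v = row_mx 0 (rsubmx (mu t u v)).
    by rewrite -[LHS]hsubmxK lsubmx_mu.
  have cw : c (rsubmx (mu t u v)) = 0 by rewrite /c -muE phiM lsubmx_mu.
  have := cE (rsubmx (mu t u v)) (rsubmx (mu t u v)).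
  rewrite cw dot0l => /esym/eqP; rewrite mulf_eq0 => /orP[/eqP rc0|/eqP/dot_eq0 w0].
    by apply: dot_eq0; rewrite cE rc0 mul0r.
  by case/eqP: uv; rewrite muE w0 row_mx0.
have phir z : phi (row_mx 0 z) = row_mx 0 (d z).
  by rewrite -[LHS]hsubmxK -/(c z) c0.
have phil x : lsubmx (phi x) = a (lsubmx x).
  rewrite -[x in LHS]hsubmxK -[row_mx _ _]addr0.
  have -> : row_mx (lsubmx x) (rsubmx x) + 0 = row_mx (lsubmx x) 0 + row_mx 0 (rsubmx x) :> V.
    by rewrite addr0 add_row_mx addr0 add0r.
  by rewrite (linD phiL) linearD /= phir row_mxKl addr0.
pose w : 'rV[R]_4 := rv4 1 0 0 0.
have w0 : w != 0 by apply/eqP; rewrite /w rv40 => /rv4_inj[/eqP]; rewrite oner_eq0.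
(* Surjectivity of [phi] forces [a] to be nonzero; below, injectivity does the same for [d]. *)
have {}ra0 : 0 < ra.
  rewrite lt_neqAle ra0 andbT eq_sym; apply: contra w0 => /eqP ra0'; apply/eqP.
  have : lsubmx (phi (psi (row_mx w 0))) = w by rewrite psiK row_mxKl.
  by rewrite phil => <-; apply: dot_eq0; rewrite aE ra0' mul0r.
have {}rd0 : 0 < rd.
  rewrite lt_neqAle rd0 andbT eq_sym; apply: contra w0 => /eqP rd0'; apply/eqP.
  have dw : d w = 0 by apply: dot_eq0; rewrite dE rd0' mul0r.
  have : row_mx 0 w = 0 :> V.
    by apply: (can_inj phiK); rewrite phir dw row_mx0 (lin0 phiL).
  by move/(congr1 rsubmx); rewrite row_mxKr linear0.
pose sa := Num.sqrt ra; pose sd := Num.sqrt rd.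
have sa0 : sa != 0 by rewrite gt_eqF // sqrtr_gt0.
have sd0 : sd != 0 by rewrite gt_eqF // sqrtr_gt0.
have sa2 : sa ^+ 2 = ra by rewrite sqr_sqrtr // ltW.
have sd2 : sd ^+ 2 = rd by rewrite sqr_sqrtr // ltW.
(* Only the diagonal blocks of [phi] are kept: the block from n1 to n2 has central values and is
   invisible to the bracket. *)
pose P (x : V) : V := row_mx (sa^-1 *: a (lsubmx x)) (sd^-1 *: d (rsubmx x)).
have PL : linear P.
  move=> k x y; rewrite /P !linearP /= aL dL scale_row_mx add_row_mx !scalerDr.
  by rewrite !scalerA ![k * _]mulrC.
have Pd x y : dot (P x) (P y) = dot x y.
  rewrite -[x in RHS]hsubmxK -[y in RHS]hsubmxK !dot_row_mx !(dotZl, dotZr) aE dE.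
  by rewrite -sa2 -sd2; field; rewrite sa0 sd0.
have PB := dot_isometry_bij PL Pd.
(* On n2, [P] is [phi] divided by [sd], while modulo n2, [phi] is [sa] times [P]; hence the factor
   sa^2 / sd. *)
pose k := ra / sd.
have Pmu x y : P (mu t x y) = k *: mu s (P x) (P y).
  have -> : P (mu t x y) = sd^-1 *: phi (mu t x y).
    rewrite -[mu t x y in RHS]hsubmxK lsubmx_mu phir scale_row_mx /P lsubmx_mu.
    by rewrite (lin0 aL) !scaler0.
  have [B _ _] := mu_lie_bracket s.
  rewrite phiM (@mu_left s _ (sa *: P x) _ (sa *: P y)).
  - rewrite (linZ (bil_l B _)) (linZ (bil_r B _)) !scalerA /k -sa2.
    by congr (_ *: _); rewrite mulrC expr2.
  - by rewrite linearZ /= row_mxKl scalerA divff // scale1r phil.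
  - by rewrite linearZ /= row_mxKl scalerA divff // scale1r phil.
have [B _ _ _] := mu_adapted t; have [B' _ _ _] := mu_adapted s.
have gI := @dot_inner R (4 + 4).
have kB : bilinear_map (fun x y => k *: mu s x y).
  split=> v h x y /=; rewrite ?(bil_l B' v h x y) ?(bil_r B' v h x y).
    by rewrite scalerDr !scalerA mulrC.
  by rewrite scalerDr !scalerA mulrC.
have nat x : P (ricci (mu t) (@dot R _) x) = k ^+ 2 *: ricci (mu s) (@dot R _) (P x).
  rewrite -ricci_scale; last exact: mu_adapted.
  exact: (ricci_natural B kB gI gI PL PB Pd Pmu).
have k2 : k ^+ 2 = 1.
  have := mu_scalar_curvature (sqr_bound ht); rewrite /scalar_curvature.
  rewrite (trace_conj (f' := fun x => k ^+ 2 *: ricci (mu s) (@dot R _) x) _ _ PL PB) //.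
  - rewrite trace_dot; under eq_bigr => i _ do rewrite dotZl.
    rewrite -mulr_sumr -trace_dot -/(scalar_curvature _ _).
    by rewrite (mu_scalar_curvature (sqr_bound hs)) mulrN1 => /oppr_inj.
  - exact: ricci_linear.
  - move=> h x y /=; rewrite (ricci_linear gI B') scalerDr !scalerA.
    by rewrite [k ^+ 2 * h]mulrC.
symmetry; apply: (ricci_rigidity ht hs PL PB) => x.
by rewrite [LHS]nat k2 scale1r.
Qed.

End HypercomplexRigidity.

(** * Isomorphism types *)

Section Endpoints.
Variable R : realType.
Notation V := 'rV[R]_(4 + 4).

Definition rv2 (a b : R) : 'rV[R]_2 := \row_i [:: a; b]`_i.
Definition rv3 (a b c : R) : 'rV[R]_3 := \row_i [:: a; b; c]`_i.

Lemma rv2_eta (x : 'rV[R]_2) : rv2 (x 0 (inord 0)) (x 0 (inord 1)) = x.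
Proof.
by apply/rowP=> i; rewrite -[i in RHS]inord_val mxE; case: i => -[|[|?]] ?.
Qed.

Lemma rv3_eta (x : 'rV[R]_3) : rv3 (x 0 (inord 0)) (x 0 (inord 1)) (x 0 (inord 2)) = x.
Proof.
by apply/rowP=> i; rewrite -[i in RHS]inord_val mxE; case: i => -[|[|[|?]]] ?.
Qed.

Lemma rv4_eta (x : 'rV[R]_4) : rv4 (co 1 x) (co 2 x) (co 3 x) (co 4 x) = x.
Proof.
have [a [b [c [d ->]]]] := rv4P x.
by have [-> -> -> ->] := co_rv4 a b c d.
Qed.

Lemma rv2_coef a b : rv2 a b 0 (inord 0) = a /\ rv2 a b 0 (inord 1) = b.
Proof. by rewrite !mxE !inordK. Qed.

Lemma rv3_coef a b c : [/\ rv3 a b c 0 (inord 0) = a, rv3 a b c 0 (inord 1) = b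
  & rv3 a b c 0 (inord 2) = c].
Proof. by rewrite !mxE !inordK. Qed.

Lemma rv2_lin k a b a' b' :
  k *: rv2 a b + rv2 a' b' = rv2 (k * a + a') (k * b + b').
Proof. by apply/rowP=> i; rewrite !mxE; case: i => -[|[|?]] ?. Qed.

Lemma rv3_lin k a b c a' b' c' :
  k *: rv3 a b c + rv3 a' b' c' = rv3 (k * a + a') (k * b + b') (k * c + c').
Proof. by apply/rowP=> i; rewrite !mxE; case: i => -[|[|[|?]]] ?. Qed.

Lemma co_lin n k (x y : 'rV[R]_4) : co n (k *: x + y) = k * co n x + co n y.
Proof. by rewrite /co !mxE. Qed.

Lemma co_left_mu n t (x y : V) : co n (lsubmx (mu t x y)) = 0.
Proof. by rewrite lsubmx_mu /co mxE. Qed.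

Lemma co_right_mu t (x y : V) : let s := Num.sqrt (1 - 3 * t ^+ 2) in
  [/\ co 1 (rsubmx (mu t x y)) = s * (wedge 1 2 x y - wedge 3 4 x y),
      co 2 (rsubmx (mu t x y)) = t * (wedge 1 2 x y + wedge 3 4 x y),
      co 3 (rsubmx (mu t x y)) = t * (wedge 1 3 x y - wedge 2 4 x y)
    & co 4 (rsubmx (mu t x y)) = t * (wedge 1 4 x y + wedge 2 3 x y)].
Proof.
move=> s; have [a [b [c [d [a1 [b1 [c1 [d1 ->]]]]]]]] := rv8P x.
have [a2 [b2 [c2 [d2 [a3 [b3 [c3 [d3 ->]]]]]]]] := rv8P y.
rewrite mu_rv4 row_mxKr /omega -/s /wedge !row_mxKl.
have [-> -> -> ->] := co_rv4 a b c d; have [-> -> -> ->] := co_rv4 a2 b2 c2 d2.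
exact: co_rv4.
Qed.

(** The surviving form is x1 y2 - x2 y1 + x4 y3 - x3 y4, so (X_1, X_2) and (X_4, X_3) are the
    Heisenberg pairs, with center Z_1; Z_2, Z_3, Z_4 span the abelian factor. *)
Lemma mu_0_g1 : lie_isomorphic (mu (0 : R)) (@g1_bracket R).
Proof.
pose phi (x : V) : R^o * ('rV[R]_2 * 'rV[R]_2) * 'rV[R]_3 :=
  let l := lsubmx x in let r := rsubmx x in
  ((co 1 r, (rv2 (co 1 l) (co 4 l), rv2 (co 2 l) (co 3 l))), rv3 (co 2 r) (co 3 r) (co 4 r)).
pose psi (y : R^o * ('rV[R]_2 * 'rV[R]_2) * 'rV[R]_3) : V :=
  row_mx (rv4 (y.1.2.1 0 (inord 0)) (y.1.2.2 0 (inord 0))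
              (y.1.2.2 0 (inord 1)) (y.1.2.1 0 (inord 1)))
         (rv4 y.1.1 (y.2 0 (inord 0)) (y.2 0 (inord 1)) (y.2 0 (inord 2))).
exists phi; last first.
  exists psi => [x|[[z [u v]] w]]; rewrite /phi /psi /=.
    have [-> ->] := rv2_coef (co 1 (lsubmx x)) (co 4 (lsubmx x)).
    have [-> ->] := rv2_coef (co 2 (lsubmx x)) (co 3 (lsubmx x)).
    have [-> -> ->] := rv3_coef (co 2 (rsubmx x)) (co 3 (rsubmx x)) (co 4 (rsubmx x)).
    by rewrite !rv4_eta hsubmxK.
  rewrite row_mxKl row_mxKr.
  have [-> -> -> ->] := co_rv4 (u 0 (inord 0)) (v 0 (inord 0)) (v 0 (inord 1)) (u 0 (inord 1)).
  have [-> -> -> ->] := co_rv4 z (w 0 (inord 0)) (w 0 (inord 1)) (w 0 (inord 2)).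
  by rewrite !rv2_eta rv3_eta.
split=> [k x y|x y].
  rewrite /phi !linearP /= !co_lin -!rv2_lin -!rv3_lin.
  by [].
rewrite /phi !co_left_mu; have [-> -> -> ->] := co_right_mu 0 x y.
rewrite expr0n /= mulr0 subr0 sqrtr1 mul1r !mul0r.
rewrite /g1_bracket /sum_bracket /heisenberg /central_bracket /abelian_bracket /=.
congr (_, _); [congr (_, _)|].
- rewrite !big_ord_recl big_ord0 !mxE /wedge /=; ring.
- by congr (_, _); apply/rowP=> -[[|[|?]] ?]; rewrite !mxE.
- by apply/rowP=> -[[|[|[|?]]] ?]; rewrite !mxE.
Qed.

(** Now the Z_1-component vanishes and Z_1 splits off. The three remaining forms are self-dual
    whereas those of Im(conj(x) y) are anti-self-dual; changing the sign of the real coordinate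
    exchanges the two kinds up to a global sign, absorbed together with t into the center. *)
Lemma mu_inv_sqrt3_g3 : lie_isomorphic (mu (Num.sqrt (3 : R))^-1) (@g3_bracket R).
Proof.
set t := (Num.sqrt 3)^-1; have t0 : t != 0.
  by rewrite invr_neq0 // gt_eqF // sqrtr_gt0 ltr0n.
have s0 : Num.sqrt (1 - 3 * t ^+ 2) = 0.
  by rewrite /t exprVn sqr_sqrtr ?ler0n // mulfV ?pnatr_eq0 // subrr sqrtr0.
pose phi (x : V) : im_quat R * quat R * R^o :=
  let l := lsubmx x in let r := rsubmx x in
  ((- (co 2 r / t), - (co 3 r / t), - (co 4 r / t)),
   (- co 1 l, co 2 l, co 3 l, co 4 l), co 1 r).
pose psi (y : im_quat R * quat R * R^o) : V :=
  let: ((a, b, c), (x1, x2, x3, x4), z1) := y in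
  row_mx (rv4 (- x1) x2 x3 x4) (rv4 z1 (- (t * a)) (- (t * b)) (- (t * c))).
exists phi; last first.
  exists psi => [x|[[[[a b] c] [[[x1 x2] x3] x4]] z1]]; rewrite /phi /psi.
    by rewrite !mulrN !(mulrC t) !divfK // !opprK !rv4_eta hsubmxK.
  rewrite row_mxKl row_mxKr.
  have [-> -> -> ->] := co_rv4 (- x1) x2 x3 x4.
  have [-> -> -> ->] := co_rv4 z1 (- (t * a)) (- (t * b)) (- (t * c)).
  by rewrite !mulNr !(mulrC t) !mulfK // !opprK.
split=> [k x y|x y].
  rewrite /phi !linearP /= !co_lin.
  by congr (_, _); congr (_, _); repeat congr (_, _); rewrite /= /GRing.scale /=; ring.
rewrite /phi !co_left_mu; have [-> -> -> ->] := co_right_mu t x y.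
rewrite s0 mul0r !(mulrC t) !mulfK // oppr0.
rewrite /g3_bracket /sum_bracket /quat_heisenberg /central_bracket /abelian_bracket /=.
by congr (_, _); congr (_, _); repeat congr (_, _); rewrite /wedge; ring.
Qed.

End Endpoints.

(** * The Lie algebra u(2), its Ad-invariant inner products, and the interior of the curve *)

Section UnitaryAlgebra.
Variable R : realType.
Notation C := R[i].
Notation V := 'rV[R]_(4 + 4).

Lemma big2 (W : nmodType) (F : 'I_2 -> W) : \sum_i F i = F 0 + F 1.
Proof.
rewrite !big_ord_recr big_ord0 /= add0r.
by congr (F _ + F _); apply: val_inj.
Qed.

Lemma ord2P (P : 'I_2 -> Prop) : P 0 -> P 1 -> forall i, P i.
Proof.
move=> h0 h1 k; have [->//|->//] : k = 0 \/ k = 1.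
by case: k => -[|[|?]] ?; [left|right|]; try exact: val_inj.
Qed.

Definition mx22 (a b c d : C) : 'M[C]_2 :=
  \matrix_(i, j) if i == 0 then (if j == 0 then a else b) else (if j == 0 then c else d).
Definition cv2 (a b : C) : 'cV[C]_2 := \col_i if i == 0 then a else b.

Lemma mx22P (x : 'M[C]_2) : x = mx22 (x 0 0) (x 0 1) (x 1 0) (x 1 1).
Proof. by apply/matrixP; apply: ord2P; apply: ord2P; rewrite !mxE. Qed.

Lemma cv2P (x : 'cV[C]_2) : x = cv2 (x 0 0) (x 1 0).
Proof. by apply/colP; apply: ord2P; rewrite !mxE. Qed.

Lemma mul_mx22 a b c d a' b' c' d' : mx22 a b c d *m mx22 a' b' c' d' =
  mx22 (a * a' + b * c') (a * b' + b * d') (c * a' + d * c') (c * b' + d * d').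
Proof. by apply/matrixP; apply: ord2P; apply: ord2P; rewrite !mxE big2 !mxE. Qed.

Lemma mul_mx22_cv2 a b c d v w : mx22 a b c d *m cv2 v w = cv2 (a * v + b * w) (c * v + d * w).
Proof. by apply/colP; apply: ord2P; rewrite !mxE big2 !mxE. Qed.

Lemma adjoint_mx22 a b c d :
  adjoint (mx22 a b c d) = mx22 (conjc a) (conjc c) (conjc b) (conjc d).
Proof. by apply/matrixP; apply: ord2P; apply: ord2P; rewrite !mxE. Qed.

(* The basis of u(2) dual to these coordinates is iI followed by the quaternion units diag(i, -i), [[0, 1], [-1, 0]], [[0, i], [i, 0]] of su(2). *)
Definition u2_mx (c0 c1 c2 c3 : R) : 'M[C]_2 :=
  mx22 (Complex 0 (c0 + c1)) (Complex c2 c3) (Complex (- c2) c3) (Complex 0 (c0 - c1)).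

Lemma u2_mx_skew c0 c1 c2 c3 : (u2_mx c0 c1 c2 c3 : realified _) \in @skew_hermitian R.
Proof.
rewrite inE /u2_mx adjoint_mx22; apply/eqP/matrixP.
by apply: ord2P; apply: ord2P; rewrite !mxE /=; apply/eqP; rewrite eq_complex /=
  ?opprK ?oppr0 !eqxx.
Qed.

Definition u2_vec c0 c1 c2 c3 : u2 R := U2 (u2_mx_skew c0 c1 c2 c3).

Lemma u2P (x : u2 R) : exists c0 c1 c2 c3, x = u2_vec c0 c1 c2 c3.
Proof.
case: x => x xs; exists ((complex.Im (x 0 0) + complex.Im (x 1 1)) / 2),
  ((complex.Im (x 0 0) - complex.Im (x 1 1)) / 2), (complex.Re (x 0 1)), (complex.Im (x 0 1)).
apply: val_inj; rewrite /= /u2_mx [LHS]mx22P.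
move: xs; rewrite inE => /eqP/matrixP xs.
have := xs 0 0; have := xs 0 1; have := xs 1 1; rewrite !mxE.
case: (x 0 0) (x 0 1) (x 1 0) (x 1 1) => [p q] [p1 q1] [p2 q2] [p3 q3] /=.
move=> /eqP; rewrite eq_complex /= => /andP[/eqP h1 _].
move=> /eqP; rewrite eq_complex /= => /andP[/eqP h2 /eqP h3].
move=> /eqP; rewrite eq_complex /= => /andP[/eqP h4 _].
by congr mx22; apply/eqP; rewrite eq_complex /=; apply/andP; split; apply/eqP; lra.
Qed.

Lemma u2_vec_lin k c0 c1 c2 c3 d0 d1 d2 d3 :
  k *: u2_vec c0 c1 c2 c3 + u2_vec d0 d1 d2 d3 =
  u2_vec (k * c0 + d0) (k * c1 + d1) (k * c2 + d2) (k * c3 + d3).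
Proof.
apply: val_inj; rewrite linearP /=; apply/matrixP.
by apply: ord2P; apply: ord2P; rewrite !mxE /=; apply/eqP; rewrite eq_complex /=;
  apply/andP; split; apply/eqP; ring.
Qed.

Section AdInvariant.
Variable B : u2 R -> u2 R -> R.
Hypotheses (BI : inner_product B) (BA : Ad_invariant B).

(** Conjugation by the unit quaternion i = diag(i, -i), the half turn about the first axis of su(2).
    [Ad_flip13] is the half turn about the second axis, by j. *)
Lemma Ad_flip23 c0 c1 c2 c3 d0 d1 d2 d3 :
  B (u2_vec c0 c1 (- c2) (- c3)) (u2_vec d0 d1 (- d2) (- d3))
  = B (u2_vec c0 c1 c2 c3) (u2_vec d0 d1 d2 d3).
Proof.
have conj a0 a1 a2 a3 : u2_mx a0 a1 (- a2) (- a3) =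
    u2_mx 0 1 0 0 *m u2_mx a0 a1 a2 a3 *m adjoint (u2_mx 0 1 0 0).
  rewrite adjoint_mx22 !mul_mx22 /u2_mx; congr mx22; apply/eqP; rewrite eq_complex /=;
  by apply/andP; split; apply/eqP; ring.
apply: (BA (g := u2_mx 0 1 0 0)) => //=.
rewrite adjoint_mx22 !mul_mx22 [RHS]mx22P !mxE /=; congr mx22; apply/eqP; rewrite eq_complex /=;
by apply/andP; split; apply/eqP; ring.
Qed.

Lemma Ad_flip13 c0 c1 c2 c3 d0 d1 d2 d3 :
  B (u2_vec c0 (- c1) c2 (- c3)) (u2_vec d0 (- d1) d2 (- d3))
  = B (u2_vec c0 c1 c2 c3) (u2_vec d0 d1 d2 d3).
Proof.
have conj a0 a1 a2 a3 : u2_mx a0 (- a1) a2 (- a3) =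
    u2_mx 0 0 1 0 *m u2_mx a0 a1 a2 a3 *m adjoint (u2_mx 0 0 1 0).
  rewrite adjoint_mx22 !mul_mx22 /u2_mx; congr mx22; apply/eqP; rewrite eq_complex /=;
  by apply/andP; split; apply/eqP; ring.
apply: (BA (g := u2_mx 0 0 1 0)) => //=.
rewrite adjoint_mx22 !mul_mx22 [RHS]mx22P !mxE /=; congr mx22; apply/eqP; rewrite eq_complex /=;
by apply/andP; split; apply/eqP; ring.
Qed.

(* Conjugation by the unit quaternion (1 + i + j + k)/2, which permutes i, j, k cyclically. *)
Lemma Ad_cycle c0 c1 c2 c3 d0 d1 d2 d3 :
  B (u2_vec c0 c3 c1 c2) (u2_vec d0 d3 d1 d2)
  = B (u2_vec c0 c1 c2 c3) (u2_vec d0 d1 d2 d3).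
Proof.
pose h : R := 2^-1.
pose g := mx22 (Complex h h) (Complex h h) (Complex (- h) h) (Complex h (- h)).
have conj a0 a1 a2 a3 : u2_mx a0 a3 a1 a2 = g *m u2_mx a0 a1 a2 a3 *m adjoint g.
  rewrite adjoint_mx22 !mul_mx22 /u2_mx; congr mx22; apply/eqP; rewrite eq_complex /=;
  by apply/andP; split; apply/eqP; rewrite /h; field.
apply: (BA (g := g)) => //=.
rewrite adjoint_mx22 !mul_mx22 [RHS]mx22P !mxE /=; congr mx22; apply/eqP; rewrite eq_complex /=;
by apply/andP; split; apply/eqP; rewrite /h; field.
Qed.

(** Any two distinct basis vectors are told apart by a half turn fixing one and negating the other,
    so the mixed entries vanish; the cyclic rotation equates the entries on su(2). The center of
    u(2) retains a scale of its own. *)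
Lemma Ad_invariant_diag : exists b0 b1, [/\ 0 < b0, 0 < b1
  & forall c0 c1 c2 c3 d0 d1 d2 d3, B (u2_vec c0 c1 c2 c3) (u2_vec d0 d1 d2 d3)
    = b0 * (c0 * d0) + b1 * (c1 * d1 + c2 * d2 + c3 * d3)].
Proof.
pose E0 := u2_vec 1 0 0 0; pose E1 := u2_vec 0 1 0 0.
pose E2 := u2_vec 0 0 1 0; pose E3 := u2_vec 0 0 0 1.
have [[Bl Br] BC Bpos] := BI.
have u2E c0 c1 c2 c3 : u2_vec c0 c1 c2 c3 = c0 *: E0 + (c1 *: E1 + (c2 *: E2 + c3 *: E3)).
  have -> : c3 *: E3 = c3 *: E3 + u2_vec 0 0 0 0.
    have -> : u2_vec 0 0 0 0 = (-1) *: u2_vec 0 0 0 0 + u2_vec 0 0 0 0.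
      by rewrite u2_vec_lin; congr u2_vec; ring.
    by rewrite scaleN1r addNr addr0.
  by rewrite !u2_vec_lin; congr u2_vec; ring.
have u2N c0 c1 c2 c3 : u2_vec (- c0) (- c1) (- c2) (- c3) = - u2_vec c0 c1 c2 c3.
  by rewrite !u2E !scaleNr !opprD.
have zero (x : R) : - x = x -> x = 0 by move=> ?; lra.
have BN x y : B x (- y) = - B x y by exact: (linN (Br x)).
have E01 : B E0 E1 = 0.
  by apply: zero; rewrite -BN -u2N -Ad_flip13 !oppr0 opprK.
have E02 : B E0 E2 = 0.
  by apply: zero; rewrite -BN -u2N -Ad_flip23 !oppr0 opprK.
have E03 : B E0 E3 = 0.
  by apply: zero; rewrite -BN -u2N -Ad_flip23 !oppr0 opprK.
have E12 : B E1 E2 = 0.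
  by apply: zero; rewrite -BN -u2N -Ad_flip23 !oppr0 opprK.
have E13 : B E1 E3 = 0.
  by apply: zero; rewrite -BN -u2N -Ad_flip23 !oppr0 opprK.
have E23 : B E2 E3 = 0.
  by apply: zero; rewrite -BN -u2N -Ad_flip13 !oppr0 opprK.
have E22 : B E2 E2 = B E1 E1 by rewrite /E1 -Ad_cycle.
have E33 : B E3 E3 = B E1 E1 by rewrite -E22 /E2 -Ad_cycle.
exists (B E0 E0), (B E1 E1); split.
- apply: Bpos; apply/eqP=> /(congr1 val)/matrixP/(_ 0 0).
  by rewrite raddf0 !mxE /= addr0 => -[/eqP]; rewrite oner_eq0.
- apply: Bpos; apply/eqP=> /(congr1 val)/matrixP/(_ 0 0).
  by rewrite raddf0 !mxE /= add0r => -[/eqP]; rewrite oner_eq0.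
move=> c0 c1 c2 c3 d0 d1 d2 d3; rewrite !u2E.
rewrite !(linD (Bl _)) !(linD (Br _)) !(linZ (Bl _)) !(linZ (Br _)).
rewrite ![B E1 E0]BC ![B E2 E0]BC ![B E3 E0]BC ![B E2 E1]BC ![B E3 E1]BC ![B E3 E2]BC.
rewrite E01 E02 E03 E12 E13 E23 E22 E33 /GRing.scale /=; ring.
Qed.

End AdInvariant.

Definition C2_vec (p1 p2 q1 q2 : R) : C2 R := cv2 (Complex p1 p2) (Complex q1 q2).

Lemma u2_form c0 c1 c2 c3 p1 p2 q1 q2 p1' p2' q1' q2' :
  C2_inner (u2_rep (u2_vec c0 c1 c2 c3) (C2_vec p1 p2 q1 q2)) (C2_vec p1' p2' q1' q2') =
    c0 * ((p1 * p2' - p2 * p1') + (q1 * q2' - q2 * q1'))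
  + c1 * ((p1 * p2' - p2 * p1') - (q1 * q2' - q2 * q1'))
  + c2 * (- ((p1 * q1' - q1 * p1') + (p2 * q2' - q2 * p2')))
  + c3 * ((p1 * q2' - q2 * p1') - (p2 * q1' - q1 * p2')).
Proof.
rewrite /u2_rep /C2_inner /= /u2_mx /C2_vec mul_mx22_cv2 mxE big2 !mxE /=; ring.
Qed.

Lemma C2_vec_lin k p1 p2 q1 q2 p1' p2' q1' q2' :
  k *: C2_vec p1 p2 q1 q2 + C2_vec p1' p2' q1' q2' =
  C2_vec (k * p1 + p1') (k * p2 + p2') (k * q1 + q1') (k * q2 + q2').
Proof.
apply/matrixP; apply: ord2P => j; rewrite !mxE /=; apply/eqP; rewrite eq_complex /=;
by apply/andP; split; apply/eqP; ring.
Qed.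

(** Rescaling Z_1 by s b0 and Z_2, Z_3, Z_4 by t b1 absorbs both the parameter and the choice of
    [B]. This requires s and t to be nonzero, which holds in the open interval. *)
Lemma mu_u2 (t : R) : 0 < t < (Num.sqrt 3)^-1 ->
  forall B : u2 R -> u2 R -> R, inner_product B -> Ad_invariant B ->
  exists2 beta : C2 R -> C2 R -> u2 R, rep_pairing B beta
    & lie_isomorphic (mu t) (central_bracket beta).
Proof.
move=> /andP[t0 t1] B BI BA; have [b0 [b1 [b0p b1p BE]]] := Ad_invariant_diag BI BA.
have b0n : b0 != 0 by rewrite gt_eqF.
have b1n : b1 != 0 by rewrite gt_eqF.
have tn : t != 0 by rewrite gt_eqF.
pose s := Num.sqrt (1 - 3 * t ^+ 2).
have sn : s != 0.
  have s3 : 0 < Num.sqrt 3 :> R by rewrite sqrtr_gt0 ltr0n.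
  rewrite gt_eqF // sqrtr_gt0 subr_gt0.
  have : t ^+ 2 < (Num.sqrt 3)^-1 ^+ 2.
    by rewrite ltrXn2r // ?nnegrE ?invr_ge0 ltW.
  by rewrite exprVn sqr_sqrtr ?ler0n // => ?; lra.
pose om c0 c1 c2 c3 v w := C2_inner (u2_rep (u2_vec c0 c1 c2 c3) v) w.
(* The [B]-dual of the functional x |-> <pi(x) v, w>: its values on the basis divided by the
   diagonal entries of [B]. *)
pose beta v w := u2_vec (om 1 0 0 0 v w / b0) (om 0 1 0 0 v w / b1)
  (om 0 0 1 0 v w / b1) (om 0 0 0 1 v w / b1).
have C2P (v : C2 R) : exists p1 p2 q1 q2, v = C2_vec p1 p2 q1 q2.
  exists (complex.Re (v 0 0)), (complex.Im (v 0 0)), (complex.Re (v 1 0)), (complex.Im (v 1 0)).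
  by rewrite [LHS]cv2P /C2_vec; case: (v 0 0) (v 1 0) => ? ? [? ?].
exists beta.
  move=> v w x; have [c0 [c1 [c2 [c3 ->]]]] := u2P x.
  have [p1 [p2 [q1 [q2 ->]]]] := C2P v; have [p3 [p4 [q3 [q4 ->]]]] := C2P w.
  by rewrite /beta BE /om !u2_form; field; rewrite b0n b1n.
(* By [u2_form] the central element iI gives a self-dual form and su(2) anti-self-dual ones, the
   opposite of [omega]. Negating the fourth coordinate of n1 corrects this and leaves minus signs at
   Z_3 and Z_4. *)
pose phi (x : V) : u2 R * C2 R := let l := lsubmx x in let r := rsubmx x in
  (u2_vec (co 1 r / (s * b0)) (co 2 r / (t * b1)) (- (co 3 r / (t * b1))) (- (co 4 r / (t * b1))),
   C2_vec (co 1 l) (co 2 l) (co 3 l) (- co 4 l)).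
pose psi (y : u2 R * C2 R) : V :=
  let x : 'M[C]_2 := u2_val y.1 in let v : 'cV[C]_2 := y.2 in
  row_mx (rv4 (complex.Re (v 0 0)) (complex.Im (v 0 0)) (complex.Re (v 1 0)) (- complex.Im (v 1 0)))
   (rv4 (s * b0 * ((complex.Im (x 0 0) + complex.Im (x 1 1)) / 2))
        (t * b1 * ((complex.Im (x 0 0) - complex.Im (x 1 1)) / 2))
        (- (t * b1 * complex.Re (x 0 1))) (- (t * b1 * complex.Im (x 0 1)))).
exists phi; last first.
  exists psi => [x|[x v]].
    rewrite /phi /psi /= !mxE /= -[RHS]hsubmxK -[lsubmx x in RHS]rv4_eta.
    rewrite -[rsubmx x in RHS]rv4_eta.
    by congr row_mx; congr rv4; rewrite ?opprK //; field; rewrite ?b0n ?b1n ?tn ?sn.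
  have [c0 [c1 [c2 [c3 ->]]]] := u2P x; have [p1 [p2 [q1 [q2 ->]]]] := C2P v.
  rewrite /phi /psi /= !mxE /= row_mxKl row_mxKr.
  have [-> -> -> ->] := co_rv4 p1 p2 q1 (- q2).
  set z1 := s * b0 * _; set z2 := t * b1 * _; set z3 := - (t * b1 * _); set z4 := - (t * b1 * _).
  have [-> -> -> ->] := co_rv4 z1 z2 z3 z4.
  by congr (_, _); [congr u2_vec; rewrite /z1 /z2 /z3 /z4; field; rewrite ?b0n ?b1n ?tn ?sn
    | rewrite opprK].
split=> [k x y|x y].
  rewrite /phi !linearP /= !co_lin /=.
  have E (a b : u2 R) (v w : C2 R) : k *: (a, v) + (b, w) = (k *: a + b, k *: v + w) by [].
  rewrite [RHS]E u2_vec_lin C2_vec_lin.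
  by congr (_, _); [congr u2_vec | congr C2_vec]; ring.
rewrite /phi !co_left_mu; have [-> -> -> ->] := co_right_mu t x y; rewrite -/s.
rewrite /central_bracket /beta /om /= !u2_form; congr (_, _).
  by congr u2_vec; rewrite /wedge; field; rewrite ?b0n ?b1n ?tn ?sn.
rewrite oppr0; apply/matrixP; apply: ord2P => j; rewrite !mxE //=.
Qed.

End UnitaryAlgebra.

(** * Symmetry of second derivatives *)

Section Differentials.
Variables (R : realType) (n : nat).
Notation V := 'rV[R]_n.

Lemma is_diff_ext (W : normedModType R) (f f' df df' : V -> W) p :
  is_diff p f df -> f =1 f' -> df =1 df' -> is_diff p f' df'.
Proof. by move=> h /funext <- /funext <-. Qed.

Lemma is_diff_ex (W : normedModType R) (f df : V -> W) p : is_diff p f df -> differentiable f p.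
Proof. by case. Qed.

Lemma is_diff_sum (W : normedModType R) k (F dF : 'I_k -> V -> W) p :
  (forall i, is_diff p (F i) (dF i)) ->
  is_diff p (fun q => \sum_i F i q) (fun v => \sum_i dF i v).
Proof.
elim: k F dF => [|k IH] F dF h.
  by apply: (is_diff_ext (is_diff_cst (0 : W) p)) => q; rewrite big_ord0.
have H := is_diffD (h ord0) (IH _ _ (fun i => h (lift ord0 i))).
by apply: (is_diff_ext H) => q; rewrite big_ord_recl.
Qed.

Lemma is_diff_coord (f df : V -> V) p i : is_diff p f df ->
  is_diff p (fun q => f q 0 i : R) (fun v => df v 0 i).
Proof.
move=> fp; pose c := fun x : V => x 0 i : R.
have cL : linear (c : V -> R^o) by move=> a u v; rewrite /c !mxE.
have cc : continuous (Lin cL : V -> R^o) by exact: coord_continuous.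
have H : is_diff (f p) (c : V -> R^o) c.
  apply: DiffDef; first exact: (linear_differentiable (f := Lin cL)).
  exact: (diff_lin (f := Lin cL)).
exact: (is_diff_comp (f := f) (g := c)).
Qed.

Lemma is_diff_scaled (W : normedModType R) (k dk : V -> R) (w : W) p :
  is_diff p k dk -> is_diff p (fun q => k q *: w) (fun v => dk v *: w).
Proof.
move=> h; apply: DiffDef; first exact: differentiableZl.
by rewrite diffZl // diff_val.
Qed.

(** No continuity of [L] is assumed: expansion in the basis reduces the claim to the coordinate
    functions. The bilinear case below works in the same way. *)
Lemma is_diff_linear (W : normedModType R) (L : V -> W) (f df : V -> V) p : linear L ->
  is_diff p f df -> is_diff p (fun q => L (f q)) (fun v => L (df v)).
Proof.
move=> hL fp.
have E x : L x = \sum_i x 0 i *: L 'e_i.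
  by rewrite {1}[x]rV_basis (lin_sum hL); apply: eq_bigr => i _; rewrite (linZ hL).
have H := is_diff_sum (fun i => is_diff_scaled (L 'e_i) (is_diff_coord i fp)).
by apply: (is_diff_ext H) => q; rewrite [RHS]E.
Qed.

Lemma is_diff_bilinear (W : normedModType R) (b : V -> V -> W) (f df g dg : V -> V) p :
  bilinear_map b -> is_diff p f df -> is_diff p g dg ->
  is_diff p (fun q => b (f q) (g q)) (fun v => b (df v) (g p) + b (f p) (dg v)).
Proof.
move=> [bl br] fp gp.
have E x y : b x y = \sum_i \sum_j (x 0 i * y 0 j) *: b 'e_i 'e_j.
  rewrite {1}[x]rV_basis (lin_sum (bl y)); apply: eq_bigr => i _; rewrite (linZ (bl y)).
  rewrite {1}[y]rV_basis (lin_sum (br _)) scaler_sumr; apply: eq_bigr => j _.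
  by rewrite (linZ (br _)) scalerA.
have H := is_diff_sum (fun i => is_diff_sum (fun j => is_diff_scaled (b 'e_i 'e_j)
  (is_diffM (is_diff_coord i fp) (is_diff_coord j gp)))).
apply: (is_diff_ext H) => q; first by rewrite [RHS]E.
rewrite !E -big_split; apply: eq_bigr => i _; rewrite -big_split; apply: eq_bigr => j _ /=.
rewrite -scalerDl; congr (_ *: _); rewrite /GRing.scale /= /GRing.scale /=.
by rewrite addrC; congr (_ + _); rewrite mulrC.
Qed.

Lemma diff_eq (W : normedModType R) (f df : V -> W) p v : is_diff p f df -> 'd f p v = df v.
Proof. by move=> h; rewrite diff_val. Qed.

Lemma is_diff_add (W : normedModType R) (f df g dg : V -> W) p :
  is_diff p f df -> is_diff p g dg ->
  is_diff p (fun q => f q + g q) (fun v => df v + dg v).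
Proof.
move=> hf hg; apply: (is_diff_ext (is_diffD hf hg)) => q; reflexivity.
Qed.

Lemma Ck_add k (f g : V -> V) : Ck k f -> Ck k g -> Ck k (fun q => f q + g q).
Proof.
elim: k f g => [|k IH] f g.
  by move=> cf cg x; exact: (continuousD (cf x) (cg x)).
move=> [df Df] [dg Dg].
have D p := is_diff_add (differentiableP (df p)) (differentiableP (dg p)).
split=> [p|v]; first exact: (is_diff_ex (D p)).
have -> : (fun p => 'd (fun q => f q + g q) p v) = (fun p => 'd f p v + 'd g p v).
  by apply: funext => p; exact: (diff_eq v (D p)).
exact: (IH _ _ (Df v) (Dg v)).
Qed.

Lemma smooth_differentiable (f : V -> V) p : smooth f -> differentiable f p.
Proof. by move=> h; have [df _] := h 1%N; exact: df. Qed.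

Lemma smooth_is_diff (f : V -> V) p : smooth f -> is_diff p f ('d f p).
Proof. by move=> /(smooth_differentiable p); exact: differentiableP. Qed.

Lemma smooth_diff (f : V -> V) v : smooth f -> smooth (fun p => 'd f p v).
Proof. by move=> h k; have [_ D] := h k.+1; exact: D. Qed.

Lemma smooth_add (f g : V -> V) : smooth f -> smooth g -> smooth (fun q => f q + g q).
Proof. by move=> hf hg k; exact: Ck_add. Qed.

Lemma smooth_cst (c : V) : smooth (fun _ => c).
Proof.
move=> k; elim: k c => [|k IH] c; first by apply: cst_continuous.
split=> [p|v]; first exact: differentiable_cst.
have -> : (fun p => 'd (fun=> c) p v) = (fun=> 0).
  by apply: funext => p; exact: (diff_eq v (is_diff_cst c p)).
exact: IH.
Qed.

Lemma smooth_id : smooth (id : V -> V).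
Proof.
case=> [|k]; first by move=> x; exact: cvg_id.
split=> [p|v]; first exact: (is_diff_ex (is_diff_id p)).
have -> : (fun p => 'd (id : V -> V) p v) = (fun=> v).
  by apply: funext => p; exact: (diff_eq v (is_diff_id p)).
exact: smooth_cst.
Qed.

(** Smoothness is kept as the hypothesis while the order k runs in the conclusion, so a derivative
    of [f] falls again under the induction hypothesis. *)
Lemma smooth_linear (L : V -> V) (f : V -> V) : linear L -> smooth f -> smooth (L \o f).
Proof.
move=> hL hf k; elim: k f hf => [|k IH] f hf.
  move=> p; apply: differentiable_continuous.
  exact: (is_diff_ex (is_diff_linear hL (smooth_is_diff p hf))).
have D p := is_diff_linear hL (smooth_is_diff p hf).
split=> [p|v]; first exact: (is_diff_ex (D p)).
have -> : (fun p => 'd (L \o f) p v) = L \o (fun p => 'd f p v).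
  by apply: funext => p; exact: (diff_eq v (D p)).
exact/IH/smooth_diff.
Qed.

Lemma smooth_bilinear (b : V -> V -> V) (f g : V -> V) : bilinear_map b ->
  smooth f -> smooth g -> smooth (fun q => b (f q) (g q)).
Proof.
move=> hb hf hg k; elim: k f g hf hg => [|k IH] f g hf hg;
  have D p := is_diff_bilinear hb (smooth_is_diff p hf) (smooth_is_diff p hg).
  by move=> p; apply: differentiable_continuous; exact: (is_diff_ex (D p)).
split=> [p|v]; first exact: (is_diff_ex (D p)).
have -> : (fun p => 'd (fun q => b (f q) (g q)) p v)
    = (fun p => b ('d f p v) (g p) + b (f p) ('d g p v)).
  by apply: funext => p; exact: (diff_eq v (D p)).
by apply: Ck_add; apply: IH => //; exact: smooth_diff.
Qed.

Lemma smooth_sum k (F : 'I_k -> V -> V) : (forall i, smooth (F i)) ->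
  smooth (fun q => \sum_i F i q).
Proof.
elim: k F => [|k IH] F h.
  rewrite (_ : (fun q => _) = fun=> 0); first exact: smooth_cst.
  by apply: funext => q; rewrite big_ord0.
rewrite (_ : (fun q => _) = fun q => F ord0 q + \sum_i F (lift ord0 i) q).
  by apply: smooth_add => //; apply: IH.
by apply: funext => q; rewrite big_ord_recl.
Qed.

Lemma coord_scale_bilinear i : bilinear_map (fun x y : V => x 0 i *: y).
Proof.
split=> v a x y /=; first by rewrite !mxE scalerDl scalerA.
by rewrite scalerDr !scalerA mulrC.
Qed.

Lemma diff_rV (f : V -> V) p v : 'd f p v = \sum_i v 0 i *: 'd f p 'e_i.
Proof. by rewrite {1}[v]rV_basis linear_sum; apply: eq_bigr => i _; rewrite linearZ. Qed.

Lemma smooth_apply (f W : V -> V) : smooth f -> smooth W ->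
  smooth (fun q => 'd f q (W q)).
Proof.
move=> hf hW; rewrite (_ : (fun q => _) = fun q => \sum_i W q 0 i *: 'd f q 'e_i).
  apply: smooth_sum => i; apply: (smooth_bilinear (coord_scale_bilinear i) hW).
  exact: smooth_diff.
by apply: funext => q; rewrite diff_rV.
Qed.

Lemma scale_linear (a : R) : linear ( *:%R a : V -> V).
Proof. by move=> k u v; rewrite scalerDr !scalerA mulrC. Qed.

(** The product rule for the differential of [f] applied to a varying vector: first the vector is
    frozen, then the differential. *)
Lemma is_diff_apply (f W dW : V -> V) p : smooth f -> is_diff p W dW ->
  is_diff p (fun q => 'd f q (W q))
    (fun w => 'd (fun q => 'd f q (W p)) p w + 'd f p (dW w)).
Proof.
move=> hf hW.
have H := is_diff_sum (fun i => is_diff_bilinear (coord_scale_bilinear i) hW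
  (smooth_is_diff p (smooth_diff 'e_i hf))).
apply: (is_diff_ext H) => q; first by rewrite [RHS]diff_rV.
rewrite big_split /= addrC -diff_rV; congr (_ + _).
have H2 := is_diff_sum (fun i => is_diff_linear (scale_linear (W p 0 i))
  (smooth_is_diff p (smooth_diff 'e_i hf))).
rewrite (_ : (fun q => 'd f q (W p)) = fun q => \sum_i W p 0 i *: 'd f q 'e_i).
  by symmetry; exact: (diff_eq _ H2).
by apply: funext => r; exact: diff_rV.
Qed.

End Differentials.

Section Schwarz.
Variables (R : realType) (n : nat).
Notation V := 'rV[R]_n.

Lemma is_derive_line (f : V -> R) a u (t : R) :
  (forall p, differentiable f p) ->
  is_derive t 1 (fun s : R => f (a + s *: u)) ('d f (a + t *: u) u).
Proof.
move=> df; have H1 : is_diff t (fun s : R => a + s *: u) (fun s => s *: u).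
  have := is_diffD (is_diff_cst a t) (is_diff_scalel t u).
  by rewrite add0r.
have H2 := is_diff_comp H1 (differentiableP (df (a + t *: u))).
have D : differentiable (f \o (fun s : R => a + s *: u)) t by [].
apply: DeriveDef; first exact: diff_derivable.
by rewrite deriveE // diff_val /= scale1r.
Qed.

Lemma mean_value_line (f : V -> R) a u (h : R) : 0 < h ->
  (forall p, differentiable f p) ->
  exists2 t, 0 < t < h & f (a + h *: u) - f a = h * 'd f (a + t *: u) u.
Proof.
move=> h0 df; have D t := is_derive_line a u t df.
have C : {within `[0, h], continuous (fun s => f (a + s *: u))}%classic.
  by apply: derivable_within_continuous => t _; case: (D t).
have [t th E] := MVT h0 (fun t _ => D t) C.
exists t; first by rewrite in_itv /= in th.
by rewrite subr0 scale0r addr0 mulrC in E.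
Qed.

(** The mean value theorem is applied first in the direction v to the increment of [f] along w, then
    in the direction w to the derivative along v. *)
Lemma second_difference (f : V -> R) p v w (h : R) : 0 < h ->
  (forall q, differentiable f q) ->
  (forall q, differentiable (fun q => 'd f q v) q) ->
  exists s t, [/\ 0 < s < h, 0 < t < h
    & f (p + h *: w + h *: v) - f (p + h *: w) - (f (p + h *: v) - f p)
      = h * (h * 'd (fun q => 'd f q v) (p + s *: v + t *: w) w)].
Proof.
move=> h0 df dv.
pose F q := f (q + h *: w) - f q.
have dF q : is_diff q F (fun u => 'd f (q + h *: w) u - 'd f q u).
  have H1 : is_diff q (fun q => q + h *: w) id.
    have := is_diffD (is_diff_id q) (is_diff_cst (h *: w) q).
    by rewrite addr0.
  exact: (is_diffB (is_diff_comp H1 (differentiableP (df (q + h *: w))))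
    (differentiableP (df q))).
have dFx q : differentiable F q by case: (dF q).
have [s sh E1] := @mean_value_line F p v h h0 dFx.
have [t th E2] := @mean_value_line (fun q => 'd f q v) (p + s *: v) w h h0 dv.
have E3 := etrans E1 (congr1 ( *%R h) (diff_eq v (dF (p + s *: v)))).
exists s, t; split; [exact: sh | exact: th|].
rewrite -[X in h * X]E2 -[RHS]E3 /F.
rewrite [p + h *: w + h *: v]addrAC; ring.
Qed.

(** The double difference is symmetric in v and w. Read in both orders it equates mixed derivatives
    at two points close to p, which contradicts distinct limits. *)
Lemma schwarz_scalar (f : V -> R) p v w :
  (forall q, differentiable f q) ->
  (forall u q, differentiable (fun q => 'd f q u) q) ->
  {for p, continuous (fun q => 'd (fun q => 'd f q v) q w)} ->
  {for p, continuous (fun q => 'd (fun q => 'd f q w) q v)} ->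
  'd (fun q => 'd f q v) p w = 'd (fun q => 'd f q w) p v.
Proof.
move=> df d2 cv cw; set a := LHS; set b := RHS.
apply/eqP; apply: contraT; rewrite -subr_eq0 => ne.
have e0 : 0 < `|a - b| / 2 by rewrite divr_gt0 // normr_gt0.
have [d1 /= d10 H1] := (nbhs_ballP _ _).1 ((cvgrPdist_lt _ _).1 cv _ e0).
have [d3 /= d30 H3] := (nbhs_ballP _ _).1 ((cvgrPdist_lt _ _).1 cw _ e0).
pose d := Num.min d1 d3; have d0 : 0 < d by rewrite lt_min d10 d30.
(* The step h = d / N keeps all intermediate points within d of p; the summand 1 keeps N positive
   when v = w = 0. *)
pose N := `|v| + `|w| + 1; have N0 : 0 < N by rewrite ltr_pwDr // addr_ge0.
pose h := d / N; have h0 : 0 < h by rewrite divr_gt0.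
have near s t x y : 0 < s < h -> 0 < t < h -> `|x| + `|y| <= `|v| + `|w| ->
    `|p - (p + s *: x + t *: y)| < d.
  move=> /andP[s0 sh] /andP[t0 th] xy.
  rewrite -addrA opprD addrA subrr sub0r normrN (le_lt_trans (ler_normD _ _)) //.
  rewrite !normrZ !gtr0_norm //.
  have : s * `|x| + t * `|y| <= h * (`|v| + `|w|).
    apply: (@le_trans _ _ (h * (`|x| + `|y|))); last by rewrite ler_wpM2l // ltW.
    by rewrite mulrDr lerD // ler_wpM2r // ltW.
  move/le_lt_trans; apply; rewrite /h -mulrA [_^-1 * _]mulrC mulrA ltr_pdivrMr //.
  by rewrite ltr_pM2l // /N ltrDl.
have apart x y : `|a - x| < `|a - b| / 2 -> `|b - y| < `|a - b| / 2 -> x = y -> false.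
  move=> A1 A2 xy; have : `|a - b| < `|a - b| / 2 + `|a - b| / 2.
    rewrite -[X in `|X| < _](subrKA y) (le_lt_trans (ler_normD _ _)) // ltrD //.
      by rewrite -xy.
    by rewrite distrC.
  by rewrite -splitr ltxx.
have [s [t [hs ht E1]]] := second_difference p w h0 df (d2 v).
have [s' [t' [hs' ht' E2]]] := second_difference p v h0 df (d2 w).
have A1 : `|a - 'd (fun q => 'd f q v) (p + s *: v + t *: w) w| < `|a - b| / 2.
  by apply: H1; rewrite -ball_normE /=; apply: lt_le_trans (near _ _ _ _ hs ht _) _ => //; rewrite ge_min lexx.
have A2 : `|b - 'd (fun q => 'd f q w) (p + s' *: w + t' *: v) v| < `|a - b| / 2.
  apply: H3; rewrite -ball_normE /=; apply: lt_le_trans (near _ _ _ _ hs' ht' _) _; first by rewrite addrC.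
  by rewrite ge_min lexx orbT.
have E : 'd (fun q => 'd f q v) (p + s *: v + t *: w) w
    = 'd (fun q => 'd f q w) (p + s' *: w + t' *: v) v.
  have h0' : h != 0 by rewrite gt_eqF.
  apply: (mulfI h0'); apply: (mulfI h0'); rewrite -E1 -E2.
  rewrite -[p + h *: v + h *: w]addrA [h *: v + _]addrC addrA; ring.
exact: apart A1 A2 E.
Qed.

Lemma schwarz (f : V -> V) p v w : smooth f ->
  'd (fun q => 'd f q v) p w = 'd (fun q => 'd f q w) p v.
Proof.
move=> hf; apply/rowP=> i; pose c (g : V -> V) q : R := g q 0 i.
have dc (g : V -> V) q : smooth g -> is_diff q (c g) (fun u => 'd g q u 0 i).
  by move=> hg; exact/is_diff_coord/smooth_is_diff.
have c1 u : (fun q => 'd (c f) q u) = c (fun q => 'd f q u).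
  by apply: funext => q; exact: (diff_eq u (dc f q hf)).
have d2 u q : is_diff q (fun q => 'd (c f) q u) (fun u' => 'd (fun q => 'd f q u) q u' 0 i).
  by rewrite c1; exact: (dc _ q (smooth_diff u hf)).
have c2 u u' : (fun q => 'd (fun q => 'd (c f) q u) q u')
    = c (fun q => 'd (fun q => 'd f q u) q u').
  by apply: funext => q; exact: (diff_eq u' (d2 u q)).
have cc u u' : {for p, continuous (fun q => 'd (fun q => 'd (c f) q u) q u')}.
  rewrite c2; apply: differentiable_continuous.
  exact: (is_diff_ex (dc _ p (smooth_diff u' (smooth_diff u hf)))).
have S := schwarz_scalar (fun q => is_diff_ex (dc f q hf)) (fun u q => is_diff_ex (d2 u q))
  (cc v w) (cc w v).
exact: (etrans (esym (diff_eq w (d2 v p))) (etrans S (diff_eq v (d2 w p)))).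
Qed.

End Schwarz.

(** * Isometries in left invariant frames *)

Section NilpotentFrames.
Variables (R : realType) (n : nat).
Notation V := 'rV[R]_n.

Section Frame.
Variable mu : V -> V -> V.
Hypothesis muN : nil2 mu.
Let muB : bilinear_map mu. Proof. by case: muN. Qed.

(** The left invariant vector field with value x at 0: the differential at 0 of left translation by
    p, applied to x. *)
Definition frame x p := x + 2^-1 *: mu p x.
(** The left Maurer-Cartan form: the differential at p of left translation by the inverse - p. *)
Definition coframe p u := u - 2^-1 *: mu p u.

Lemma frameK x p : coframe p (frame x p) = x.
Proof.
rewrite /coframe /frame (linD (bil_r muB p)) (linZ (bil_r muB p)) nil2_central //.
by rewrite scaler0 addr0 addrK.
Qed.

Lemma is_diff_half_bracket x p :
  is_diff p (fun q : V => 2^-1 *: mu q x) (fun v => 2^-1 *: mu v x).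
Proof.
have L : linear (fun q : V => 2^-1 *: mu q x).
  by move=> k u v; rewrite (bil_l muB x k u v) scalerDr !scalerA mulrC.
exact: (is_diff_linear L (is_diff_id p)).
Qed.

Lemma is_diff_frame x p : is_diff p (frame x) (fun v => 2^-1 *: mu v x).
Proof.
apply: (is_diff_ext (is_diff_add (is_diff_cst x p) (is_diff_half_bracket x p))) => q //.
exact: add0r.
Qed.

Lemma smooth_frame x : smooth (frame x).
Proof.
have L : linear (fun q : V => 2^-1 *: mu q x).
  by move=> k u v; rewrite (bil_l muB x k u v) scalerDr !scalerA mulrC.
exact: (smooth_add (smooth_cst x) (smooth_linear L (@smooth_id R n))).
Qed.

Lemma left_invariant_metricE p u v :
  left_invariant_metric mu (@dot R n) p u v = dot (coframe p u) (coframe p v).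
Proof.
have D : is_diff p (nil_mul mu (- p)) (coframe p).
  have L : linear (fun q : V => 2^-1 *: mu (- p) q).
    by move=> k x y; rewrite (bil_r muB (- p) k x y) scalerDr !scalerA mulrC.
  have H := is_diff_add (is_diff_add (is_diff_cst (- p) p) (is_diff_id p))
    (is_diff_linear L (is_diff_id p)).
  apply: (is_diff_ext H) => q; first by [].
  by rewrite /coframe add0r (linN (bil_l muB q)) scalerN.
rewrite /left_invariant_metric.
exact: (congr2 (@dot R n) (diff_eq u D) (diff_eq v D)).
Qed.

(* The derivative of phi along the left invariant vector field x. *)
Definition along (phi : V -> V) x p := 'd phi p (frame x p).

Lemma smooth_along phi x : smooth phi -> smooth (along phi x).
Proof. by move=> h; exact: (smooth_apply h (smooth_frame x)). Qed.

Lemma along_linear phi p : linear (fun x => along phi x p).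
Proof.
move=> k x y; rewrite /along -linearP /frame (bil_r muB p k x y).
by rewrite !scalerDr !scalerA addrACA [k * _]mulrC.
Qed.

Lemma along_bracket phi x y p : along phi (mu x y) p = 'd phi p (mu x y).
Proof. by rewrite /along /frame nil2_central // scaler0 addr0. Qed.

(** The last term comes from the variation of the field of y in the direction of the field of x,
    which is half the bracket because double brackets vanish. *)
Lemma along_along phi x y p : smooth phi -> along (along phi y) x p =
  'd (fun q => 'd phi q (frame y p)) p (frame x p) + 'd phi p (2^-1 *: mu x y).
Proof.
move=> h; have D := is_diff_apply h (is_diff_frame y p).
apply: (etrans (diff_eq (frame x p) D)); congr (_ + 'd phi p (_ *: _)).
rewrite /frame (linD (bil_l muB y)) (linZ (bil_l muB y)); case: muN => _ _ ->.
by rewrite scaler0 addr0.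
Qed.

(** The second derivatives cancel by symmetry and the two half brackets add up: left invariant
    fields commute according to [mu]. *)
Lemma along_commutator phi x y p : smooth phi ->
  along (along phi y) x p - along (along phi x) y p = along phi (mu x y) p.
Proof.
move=> h; have H (L : V -> V) (D D' c c' : V) : linear L -> D = D' -> c' = - c ->
    D + L (2^-1 *: c) - (D' + L (2^-1 *: c')) = L c.
  move=> hL -> ->; rewrite scalerN (linN hL) opprD opprK addrACA subrr add0r -(linD hL).
  by rewrite -mulr2n -scaler_nat scalerA mulfV ?scale1r // pnatr_eq0.
have dL : linear ('d phi p : V -> V) by move=> k u v; exact: linearP.
have S := schwarz p (frame y p) (frame x p) h.
have E := congr2 (fun a b : V => a - b) (along_along x y p h) (along_along y x p h).
exact: (etrans E (etrans (H _ _ _ _ _ dL S (nil2_anti x y muN)) (esym (along_bracket phi x y p)))).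
Qed.

End Frame.

Section Isometry.
Variables (mu mu' : V -> V -> V) (f : V -> V).
Hypotheses (muN : nil2 mu) (muN' : nil2 mu') (fS : smooth f).
Let muB : bilinear_map mu. Proof. by case: muN. Qed.
Let muB' : bilinear_map mu'. Proof. by case: muN'. Qed.
Let gI := @dot_inner R n.
Notation G := (levi_civita mu (@dot R n)).
Notation G' := (levi_civita mu' (@dot R n)).

(* The differential of f read in the left invariant frames. *)
Definition framed_diff x p := coframe mu' (f p) (along mu f x p).
Notation A := framed_diff.

Lemma half_bilinear : bilinear_map (fun x y => - (2^-1 *: mu' x y)).
Proof.
split=> v k x y; rewrite ?(bil_l muB' v k x y) ?(bil_r muB' v k x y).
  by rewrite scalerDr opprD !scalerA scalerN scalerA mulrC.
by rewrite scalerDr opprD !scalerA scalerN scalerA mulrC.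
Qed.

Lemma smooth_framed_diff x : smooth (A x).
Proof.
have S := smooth_along muN x fS.
exact: (smooth_add S (smooth_bilinear half_bilinear fS S)).
Qed.

Lemma framed_diff_linear p : linear (A^~ p).
Proof.
move=> k x y; rewrite /A /coframe (along_linear muN f p k x y).
rewrite (linD (bil_r muB' _)) (linZ (bil_r muB' _)) scalerDr opprD addrACA.
by rewrite scalerBr !scalerA mulrC.
Qed.

(** [A x p] differs from the derivative of [f] along x by a bracket, which is central. *)
Lemma framed_bracket x y p :
  mu' (A x p) (A y p) = mu' (along mu f x p) (along mu f y p).
Proof.
have c u v w : mu' u (v - 2^-1 *: mu' w v) = mu' u v.
  by rewrite (linB (bil_r muB' u)) (linZ (bil_r muB' u)) nil2_central // scaler0 subr0.
by rewrite /A /coframe c nil2_anti // c -nil2_anti.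
Qed.

Lemma along_framed_diff x y p : along mu (A y) x p =
  coframe mu' (f p) (along mu (along mu f y) x p)
  - 2^-1 *: mu' (along mu f x p) (along mu f y p).
Proof.
have D1 := smooth_is_diff p (smooth_along muN y fS).
have D := is_diff_add D1 (is_diff_bilinear half_bilinear (smooth_is_diff p fS) D1).
apply: (etrans (diff_eq (frame mu x p) D)).
by rewrite /coframe -addrA [X in _ + X]addrC addrA.
Qed.

(** The structure equation for the pullback of the Maurer-Cartan form, valid for every smooth [f].
    The first part is the commutator applied to [f]; the rest comes from differentiating the coframe
    at [f p], where two half brackets combine. *)
Lemma maurer_cartan x y p : along mu (A y) x p - along mu (A x) y p =
  A (mu x y) p - mu' (A x p) (A y p).
Proof.
rewrite !along_framed_diff framed_bracket.
have L : linear (coframe mu' (f p)).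
  move=> k u v; rewrite /coframe (bil_r muB' _ k u v) scalerDr opprD addrACA.
  by rewrite scalerBr !scalerA mulrC.
rewrite [A (mu x y) p]/A -along_commutator // (linB L).
rewrite (nil2_anti (along mu f x p) (along mu f y p)) // scalerN opprK.
set a := coframe _ _ _; set b := coframe _ _ _; set c := mu' _ _.
have -> : a - 2^-1 *: c - (b + 2^-1 *: c) = a - b - (2^-1 *: c + 2^-1 *: c).
  by move: a b c => a b c; apply/rowP=> i; rewrite !mxE; ring.
congr (_ - _).
by rewrite -mulr2n -scaler_nat scalerA mulfV ?scale1r // pnatr_eq0.
Qed.

Lemma levi_civita_torsion (nu : V -> V -> V) u v : nil2 nu ->
  levi_civita nu (@dot R n) u v - levi_civita nu (@dot R n) v u = nu u v.
Proof.
move=> N; have B : bilinear_map nu by case: N.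
apply: dot_inj => w; rewrite dotBl !(koszul gI) //.
rewrite (nil2_anti u v N) (nil2_anti u w N) (nil2_anti v w N) !dotNl; lra.
Qed.

(* The hypothesis is the commutator of two covariant derivatives, written out by means of the connection formula below. *)
Lemma curvature_intertwine (a : V -> V) x y z : linear a ->
  a (G x (G y z)) - G' (a x) (a (G y z))
    - (G' (a (G x y) - G' (a x) (a y)) (a z) + G' (a y) (a (G x z) - G' (a x) (a z)))
  - (a (G y (G x z)) - G' (a y) (a (G x z))
    - (G' (a (G y x) - G' (a y) (a x)) (a z) + G' (a x) (a (G y z) - G' (a y) (a z))))
  = a (G (mu x y) z) - G' (a (mu x y)) (a z) ->
  a (curvature mu (@dot R n) x y z) = curvature mu' (@dot R n) (a x) (a y) (a z).
Proof.
move=> aL; have Gl' := levi_civita_l gI muB'; have Gr' := levi_civita_r gI muB'.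
have curvE (nu : V -> V -> V) u v w : curvature nu (@dot R n) u v w =
  levi_civita nu (@dot R n) u (levi_civita nu (@dot R n) v w)
  - levi_civita nu (@dot R n) v (levi_civita nu (@dot R n) u w)
  - levi_civita nu (@dot R n) (nu u v) w by [].
have ta : a (mu x y) = a (G x y) - a (G y x) by rewrite -(linB aL) levi_civita_torsion.
rewrite (curvE mu) (curvE mu') -(levi_civita_torsion (a x) (a y) muN') ta.
rewrite !(linB (Gl' (a z))) !(linB (Gr' (a x))) !(linB (Gr' (a y))) !(linB aL).
move: (a (G x (G y z))) (a (G y (G x z))) (a (G (mu x y) z)).
move: (G' (a x) (a (G y z))) (G' (a y) (a (G x z))).
move: (G' (a (G x y)) (a z)) (G' (a (G y x)) (a z)).
move: (G' (G' (a x) (a y)) (a z)) (G' (G' (a y) (a x)) (a z)).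
move: (G' (a x) (G' (a y) (a z))) (G' (a y) (G' (a x) (a z))).
move=> a1 a2 a3 a4 a5 a6 a7 a8 a9 a10 a11 E.
by apply/rowP=> i; move/rowP/(_ i): E; rewrite !mxE => E; lra.
Qed.

Hypothesis fI : forall p u v, left_invariant_metric mu' (@dot R n) (f p) ('d f p u) ('d f p v)
  = left_invariant_metric mu (@dot R n) p u v.

Lemma framed_diff_orthogonal x y p : dot (A x p) (A y p) = dot x y.
Proof.
by rewrite -[LHS](left_invariant_metricE muN') fI left_invariant_metricE // !frameK.
Qed.

Lemma framed_diff_skew u x y p :
  dot (along mu (A x) u p) (A y p) = - dot (A x p) (along mu (A y) u p).
Proof.
have B : bilinear_map (fun x y : V => dot x y : R^o).
  by split; [exact: dotl | exact: dotr].
have D := is_diff_bilinear B (smooth_is_diff p (smooth_framed_diff x))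
  (smooth_is_diff p (smooth_framed_diff y)).
have D0 : is_diff p (fun q => dot (A x q) (A y q) : R^o) (fun _ => 0).
  apply: (is_diff_ext (is_diff_cst (dot x y : R^o) p)) => q; last by [].
  by rewrite framed_diff_orthogonal.
apply/eqP; rewrite -addr_eq0; apply/eqP.
exact: (etrans (esym (diff_eq (frame mu u p) D)) (diff_eq (frame mu u p) D0)).
Qed.

(* Koszul: the Maurer-Cartan equation gives the part of the derivative of A antisymmetric in x, y, and orthogonality makes it skew in its values. *)
Lemma framed_diff_connection x y p :
  along mu (A y) x p = A (G x y) p - G' (A x p) (A y p).
Proof.
have bij : bijective (A^~ p).
  apply: dot_isometry_bij; first exact: framed_diff_linear.
  by move=> u v; exact: framed_diff_orthogonal.
have [Q AQ QA] := bij; apply: dot_inj => w; rewrite -(QA w); move: (Q w) => z.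
(* Introduced through an existential so that the derivatives of [A] become opaque atoms for
   [lra]. *)
have [tau tauE] : exists tau : V -> V -> V -> R,
    forall u v w', dot (along mu (A v) u p) (A w' p) = tau u v w'.
  by exists (fun u v w' => dot (along mu (A v) u p) (A w' p)).
have T u v w' : tau u v w' - tau v u w'
    = dot (mu u v) w' - dot (mu' (A u p) (A v p)) (A w' p).
  rewrite -!tauE -(framed_diff_orthogonal (mu u v) w' p).
  have := congr1 (fun a => dot a (A w' p)) (maurer_cartan u v p).
  by rewrite /= dotBl [X in _ = X -> _]dotBl.
have S u v w' : tau u v w' = - tau u w' v.
  by rewrite -!tauE; apply: (etrans (framed_diff_skew u v w' p)); rewrite dotC.
have E1 := etrans (framed_diff_orthogonal (G x y) z p) (koszul gI muB x y z).
have E2 := koszul gI muB' (A x p) (A y p) (A z p).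
apply: (etrans (tauE x y z)); apply: (etrans _ (esym (dotBl _ _ _))).
apply: (etrans _ (esym (congr2 (fun a b : R => a - b) E1 E2))).
(* The three cyclic instances together with the skewness [S] determine [tau], as in the uniqueness
   proof for the Levi-Civita connection. *)
have := T x y z; have := T y z x; have := T z x y.
rewrite (S x z y) (S y x z) (S z y x).
move: (dot (mu' _ _) _) (dot (mu' _ _) _) (dot (mu' _ _) _) => c1 c2 c3.
lra.
Qed.

(** The connection formula expresses a derivative of [A] through [A] alone, so it can be
    differentiated again. Commuting the two derivatives by [along_commutator] yields the
    integrability condition, which is the equality of curvatures. *)
Lemma framed_curvature x y z p :
  A (curvature mu (@dot R n) x y z) p =
  curvature mu' (@dot R n) (A x p) (A y p) (A z p).
Proof.
have Gl' := levi_civita_l gI muB'; have Gr' := levi_civita_r gI muB'.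
have second u v : along mu (along mu (A z) v) u p =
    along mu (A (G v z)) u p
    - (G' (along mu (A v) u p) (A z p) + G' (A v p) (along mu (A z) u p)).
  have BG : bilinear_map (fun x y => - G' x y).
    by split=> w k s t; rewrite ?(Gl' w k s t) ?(Gr' w k s t) opprD scalerN.
  have E : along mu (A z) v = fun q => A (G v z) q + - G' (A v q) (A z q).
    by apply: funext => q; exact: framed_diff_connection.
  apply: (etrans (congr1 (fun F : V -> V => along mu F u p) E)).
  have D w := smooth_is_diff p (smooth_framed_diff w).
  have H := is_diff_add (D (G v z)) (is_diff_bilinear BG (D v) (D z)).
  apply: (etrans (diff_eq (frame mu u p) H)); congr (_ + _).
  exact/esym/opprD.
have E : along mu (along mu (A z) y) x p - along mu (along mu (A z) x) y p
    = along mu (A z) (mu x y) p.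
  exact: (along_commutator muN x y p (smooth_framed_diff z)).
have {}second u v : along mu (along mu (A z) v) u p =
    A (G u (G v z)) p - G' (A u p) (A (G v z) p)
    - (G' (A (G u v) p - G' (A u p) (A v p)) (A z p)
      + G' (A v p) (A (G u z) p - G' (A u p) (A z p))).
  apply: (etrans (second u v)); congr (_ - (G' _ _ + G' _ _));
  exact: framed_diff_connection.
have {}E := etrans (esym (congr2 (fun a b : V => a - b) (second x y) (second y x)))
  (etrans E (framed_diff_connection (mu x y) z p)).
exact: (curvature_intertwine (framed_diff_linear p) E).
Qed.

End Isometry.
End NilpotentFrames.

Section IsometryRigidity.
Variable R : realType.

Lemma isometry_rigidity (s t : R) :
  0 <= s <= (Num.sqrt 3)^-1 -> 0 <= t <= (Num.sqrt 3)^-1 ->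
  isometric_manifolds (left_invariant_metric (mu s) (@ip R))
    (left_invariant_metric (mu t) (@ip R)) -> s = t.
Proof.
move=> hs ht [f [_ [fS _ _ _ fI]]].
(* Any base point would serve, as the metric and the curvature have constant coefficients in the
   frames. *)
pose P x := framed_diff (mu s) (mu t) f x 0.
have Ns := adapted_nil2 (mu_adapted s); have Nt := adapted_nil2 (mu_adapted t).
have PL : linear P by exact: framed_diff_linear.
have Pd x y : dot (P x) (P y) = dot x y by exact: framed_diff_orthogonal.
have PB : bijective P by exact: dot_isometry_bij.
have gI := @dot_inner R (4 + 4).
have Bs : bilinear_map (mu s) by case: Ns.
have Bt : bilinear_map (mu t) by case: Nt.
apply: (ricci_rigidity hs ht PL PB).
apply: (ricci_natural_curvature Bs Bt gI gI PL PB Pd) => x y z.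
exact: framed_curvature.
Qed.

End IsometryRigidity.

Theorem mainTheorem5 (R : realType) :
  [/\
    forall t : R, 0 <= t <= (Num.sqrt 3)^-1 ->
      [/\ hypercomplex (mu t) (@J1 R) (@J2 R) (@J3 R),
          mu t (X R 2) (X R 3) + mu t (X R 1) (X R 4) = (2 * t) *: Z R 4,
          abelian_hypercomplex (mu t) (@J1 R) (@J2 R) (@J3 R) <-> t = 0
        & minimal_metric (mu t) (@J1 R) (@J2 R) (@J3 R) (@ip R)],
    [/\ forall t : R, 0 <= t <= (Num.sqrt 3)^-1 ->
          [/\ ricci (mu t) (@ip R) (Z R 1) = (1 - 3 * t ^+ 2) *: Z R 1,
              ricci (mu t) (@ip R) (Z R 2) = t ^+ 2 *: Z R 2,
              ricci (mu t) (@ip R) (Z R 3) = t ^+ 2 *: Z R 3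
            & ricci (mu t) (@ip R) (Z R 4) = t ^+ 2 *: Z R 4],
        forall s t : R, 0 <= s <= (Num.sqrt 3)^-1 -> 0 <= t <= (Num.sqrt 3)^-1 ->
          s != t ->
          ~ isometric_manifolds (left_invariant_metric (mu s) (@ip R))
                                (left_invariant_metric (mu t) (@ip R))
      & forall s t : R, 0 <= s <= (Num.sqrt 3)^-1 -> 0 <= t <= (Num.sqrt 3)^-1 ->
          s != t ->
          ~ hypercomplex_isomorphic (mu s) (@J1 R) (@J2 R) (@J3 R)
                                    (mu t) (@J1 R) (@J2 R) (@J3 R)]
  & [/\ lie_isomorphic (mu (0 : R)) (@g1_bracket R),
        lie_isomorphic (mu (Num.sqrt (3 : R))^-1) (@g3_bracket R)
      & forall t : R, 0 < t < (Num.sqrt 3)^-1 ->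
          forall B : u2 R -> u2 R -> R, inner_product B -> Ad_invariant B ->
          exists2 beta : C2 R -> C2 R -> u2 R, rep_pairing B beta
            & lie_isomorphic (mu t) (central_bracket beta)]].
Proof.
split.
- move=> t ht; have t1 := sqr_bound ht; split.
  + exact: mu_hypercomplex.
  + have [_ _ _ [_ -> ->]] := mu_table t.
    by rewrite -scalerDl -mulr2n mulr_natl.
  + exact: mu_abelian.
  + exact: mu_minimal.
- split.
  + move=> t ht; have t1 := sqr_bound ht; rewrite /Z; have [-> -> -> ->] := e_rv4 R.
    by rewrite rv40 !mu_ricci // !scale_row_mx !rv4Z !(mulr0, mulr1).
  + by move=> s t hs ht st /(isometry_rigidity hs ht)/eqP; rewrite (negPf st).
  + by move=> s t hs ht st /(hypercomplex_rigidity hs ht)/eqP; rewrite (negPf st).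
- by split; [exact: mu_0_g1 | exact: mu_inv_sqrt3_g3 | exact: mu_u2].
Qed.
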